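(* Let $\mu$ be the probability measure on the unit circle $\partial\mathbb{D}$ whose Verblunsky coefficients are $$\alpha_n=\frac{1+(-1)^n}{3(n+1)^{1/4}},\qquad n\ge 0,$$ and let $w$ be the density of its absolutely continuous part, i.e. $d\mu = w(\theta)\frac{d\theta}{2\pi}+d\mu_{\mathrm{s}}$ with $\mu_{\mathrm{s}}$ singular with respect to Lebesgue measure. Let $S$ be the shift operator on sequences and $\alpha=\{\alpha_n\}_{n=0}^\infty$. Then $(S-1)^2(S+1)\alpha\in\ell^2$ and $\alpha\in\ell^6$, but $$\int_0^{2\pi} (1-\cos\theta)^2(1+\cos\theta)\log w(\theta)\,\frac{d\theta}{2\pi}=-\infty.$$
   Context: Here $\mathbb{D}=\{z\in\mathbb{C}: |z|<1\}$ and $\partial\mathbb{D}=\{e^{i\theta}:\theta\in[0,2\pi)\}$. For a probability measure $\mu$ on $\partial\mathbb{D}$ with infinite support, the Gram–Schmidt process applied to $1,z,z^2,\dots$ in $L^2(\partial\mathbb{D},d\mu)$ yields orthonormal polynomials $\varphi_n(z)$ (degree $n$, positive leading coefficient). They obey the recursion $z\varphi_n(z)=\sqrt{1-|\alpha_n|^2}\,\varphi_{n+1}(z)+\bar\alpha_n\varphi_n^*(z)$, where $\varphi_n^*(z)=z^n\overline{\varphi_n(1/\bar z)}$; the numbers $\alpha_n\in\mathbb{D}$, $n\ge 0$, are called the Verblunsky coefficients of $\mu$. By Verblunsky's theorem, $\mu\mapsto\{\alpha_n\}_{n=0}^\infty$ is a bijection from such measures onto $\mathbb{D}^\infty$. The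 shift operator $S$ acts on complex sequences by $(Sx)_n=x_{n+1}$, $n\ge0$; polynomials in $S$ are understood accordingly, with $1$ the identity. $\ell^p$ denotes the space of $p$-summable complex sequences indexed by $n\ge 0$. Since $\log w\le w-1$ with $w\in L^1$, the integral is well defined as an element of $[-\infty,\infty)$ (with $\log 0=-\infty$). *)

(* Defs.v *)
From HB Require Import structures.
From mathcomp Require Import all_boot all_order all_algebra.
From mathcomp Require Import all_classical all_reals all_analysis.
From mathcomp Require Import complex.
Import Order.TTheory GRing.Theory Num.Theory.
Import numFieldNormedType.Exports.

Set Implicit Arguments.
Unset Strict Implicit.
Unset Printing Implicit Defensive.

Local Open Scope classical_set_scope.
Local Open Scope complex_scope.
Local Open Scope ring_scope.

(* The complex plane with its Borel sigma-algebra.  The regular module R[i]^o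
   is what carries the topology of the modulus.  A measure on the unit circle
   is a measure on the plane that gives full mass to [unit_circle]. *)
Definition borelC (R : realType) := g_sigma_algebraType (@open (R[i]^o)).

Definition unit_circle (R : realType) : set (borelC R) :=
  [set z : R[i] | `|z| = 1].

Definition expi (R : realType) (t : R) : R[i] := cos t +i* sin t.

Definition angles (R : realType) : set R := `[0, 2 * pi[.

Definition measure_support (R : realType)
    (mu : {measure set (borelC R) -> \bar R}) : set R[i] :=
  [set z | forall U : set (R[i]^o), open U -> U z -> (0 < mu U)%E].

Section OrthogonalPolynomials.
Variables (R : realType) (mu : {measure set (borelC R) -> \bar R}).

Definition cintegral (f : R[i] -> R[i]) : R[i] :=
  (\int[mu]_(z in @unit_circle R) complex.Re (f z)) +i*
  (\int[mu]_(z in @unit_circle R) complex.Im (f z)).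

(* Linear in the first argument. *)
Definition inner (p q : {poly R[i]}) : R[i] :=
  cintegral (fun z => p.[z] * (q.[z])^*).

Definition l2norm (p : {poly R[i]}) : R := Num.sqrt (complex.Re (inner p p)).

Definition gs_step (s : seq {poly R[i]}) (p : {poly R[i]}) : {poly R[i]} :=
  let r := p - \sum_(q <- s) inner p q *: q in ((l2norm r)^-1)%:C *: r.

(* [:: phi_0; ...; phi_(n-1)], from 1, 'X, ..., 'X^(n-1) *)
Fixpoint gram_schmidt (n : nat) : seq {poly R[i]} :=
  if n is m.+1 then rcons (gram_schmidt m) (gs_step (gram_schmidt m) 'X^m)
  else [::].

Definition opuc (n : nat) : {poly R[i]} := gs_step (gram_schmidt n) 'X^n.

End OrthogonalPolynomials.

(* p^*(z) = z^n conj(p(1 / conj z)) as a polynomial; see [horner_revpoly]. *)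
Definition revpoly (R : realType) (n : nat) (p : {poly R[i]}) : {poly R[i]} :=
  \poly_(i < n.+1) (p`_(n - i))^*.

Lemma horner_revpoly (R : realType) (n : nat) (p : {poly R[i]}) (z : R[i]) :
  (size p <= n.+1)%N -> z != 0 ->
  (revpoly n p).[z] = z ^+ n * (p.[(z^*)^-1])^*.
Proof.
move=> sp z0; rewrite horner_poly (horner_coef_wide _ sp) rmorph_sum mulr_sumr.
rewrite (reindex_inj rev_ord_inj) /=; apply: eq_bigr => i _.
have lin : (i <= n)%N by rewrite -ltnS.
rewrite subSS subKn // rmorphM rmorphXn fmorphV /= conjCK mulrCA; congr (_ * _).
by rewrite exprVn expfB_cond // (negbTE z0).
Qed.

Definition verblunsky (R : realType) (mu : {measure set (borelC R) -> \bar R})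
    (a : nat -> R[i]) : Prop :=
  forall n, Normc.normc (a n) < 1 /\
    'X * opuc mu n = (Num.sqrt (1 - Normc.normc (a n) ^+ 2))%:C *: opuc mu n.+1
                     + (a n)^* *: revpoly n (opuc mu n).

(* mu = w dtheta/2pi + mus with mus singular to arc length; functions on the
   circle are functions of the angle in [0, 2pi[. *)
Definition ac_density (R : realType) (mu : {measure set (borelC R) -> \bar R})
    (w : R -> R) : Prop :=
  [/\ measurable_fun (@angles R) w,
      (forall t, angles t -> 0 <= w t) &
      exists mus : {measure set (borelC R) -> \bar R},
        (exists N : set (borelC R), [/\ measurable N,
           lebesgue_measure (@angles R `&` @expi R @^-1` N) = 0%E &
           mus (~` N) = 0%E]) /\
        (forall A : set (borelC R), measurable A ->
           mu A = (\int[lebesgue_measure]_(t in @angles R `&` @expi R @^-1` A)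
                     (w t / (2 * pi))%:E + mus A)%E)].

Definition shift (R : realType) (x : nat -> R[i]) : nat -> R[i] :=
  fun n => x n.+1.

(* The operator p(S), S being [shift]. *)
Definition shift_poly (R : realType) (p : {poly R[i]}) (x : nat -> R[i]) :
    nat -> R[i] :=
  fun n => \sum_(i < size p) p`_i * iter i (@shift R) x n.

(* x is in ell^p, for 0 < p < +oo. *)
Definition ell (R : realType) (p : R) (x : nat -> R[i]) : Prop :=
  (\sum_(0 <= n <oo) (Normc.normc (x n) `^ p)%:E < +oo)%E.

Definition alpha (R : realType) : nat -> R[i] :=
  fun n => ((1 + (-1) ^+ n) / (3 * n.+1%:R `^ 4^-1))%:C.

(* Main.v *)
Require Import Defs.
From HB Require Import structures.
From mathcomp Require Import all_boot all_order all_algebra.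
From mathcomp Require Import all_classical all_reals all_analysis.
From mathcomp Require Import measurable_realfun complex.
From mathcomp Require Import ring lra zify.
Import Order.TTheory GRing.Theory Num.Theory.
Import numFieldNormedType.Exports.
Local Open Scope classical_set_scope.
Local Open Scope ring_scope.

Set Implicit Arguments.
Unset Strict Implicit.
Unset Printing Implicit Defensive.

(** The reversed polynomial [q_n] of [phi_n] has no zero in the closed disc and
    the same modulus as [phi_n] on the circle.  Splitting it into linear factors
    shows that the mean of [(1 - cos)^2 (1 + cos) ln |q_n|^2] depends only on
    the Taylor coefficients of [log q_n] of order at most 3.  Under the Szego
    recursion with vanishing odd coefficients, and with [a_k = alpha_2k], those
    of order 1 and 3 are eventually constant, so that each double step adds
    [(- ln (1 - a_k^2) - a_{k-1} a_k) / 2], which up to a telescoping term is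
    at least [a_k^4 / 8], a multiple of [1 / (2 k + 1)].  Hence the means
    diverge.  On the other hand
    [ln (w |phi_n|^2) <= w |phi_n|^2], whose integral is bounded in [n] by
    orthonormality; this forces the integral of the weighted [ln w] to be
    [-oo]. *)

(** The weight has mean 1/2 and coefficient -1/2 at [cos (2 t)]. In a double step the value of [q_n]
    at 0 therefore contributes half of [- ln (1 - a_k^2)], and the second Taylor coefficient of
    [log q_n], which moves by [a_{k-1} a_k], contributes minus half of that product. The quadratic
    parts nearly cancel: [a_k^2 - a_{k-1} a_k = - a_k (a_{k-1} - a_k)] is bounded below by a
    telescoping difference, because [a_k] decreases within (0, 1). So the fourth-order term decides,
    and the exponent 1/4 puts [a_k^4] on the harmonic scale while [a_k^6] stays summable.

    No limit in [n] is ever taken: neither asymptotics of [phi_n] nor convergence of measures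
    enters. For each fixed [n] the inequality bounds the integral of the negative part of the
    weighted [ln w] from below by a mean minus a constant, and these lower bounds are unbounded. *)

(** * Normalised means of continuous functions over the circle *)

Section CircleMean.
Variable R : realType.
Implicit Types (f g : R -> R) (z u : R[i]) (t r : R).

Local Notation leb := (@lebesgue_measure R).

Definition circle_mean f : R := (2 * pi)^-1 * \int[leb]_(t in @angles R) f t.

Lemma continuous_fD f g :
  continuous f -> continuous g -> continuous (fun t => f t + g t).
Proof. by move=> cf cg t; apply: cvgD; [exact: cf|exact: cg]. Qed.

Lemma continuous_fM f g :
  continuous f -> continuous g -> continuous (fun t => f t * g t).
Proof. by move=> cf cg t; apply: cvgM; [exact: cf|exact: cg]. Qed.

Lemma continuous_fZ r f : continuous f -> continuous (fun t => r * f t).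
Proof. by move=> cf t; apply: cvgM; [exact: cvg_cst|exact: cf]. Qed.

Lemma twopi_gt0 : 0 < 2 * pi :> R.
Proof. by rewrite mulr_gt0// pi_gt0. Qed.

Lemma measurable_angles : measurable (@angles R).
Proof. exact: measurable_itv. Qed.

Lemma lebesgue_angles : leb (@angles R) = (2 * pi)%:E.
Proof.
by rewrite /angles lebesgue_measure_itv/= lte_fin twopi_gt0 -EFinB subr0.
Qed.

Lemma continuous_integrable_segment f :
  continuous f -> leb.-integrable `[0, 2 * pi] (EFin \o f).
Proof.
move=> cf; apply: (@continuous_compact_integrable R f); first exact: segment_compact.
exact: continuous_subspaceT.
Qed.

Lemma continuous_integrable_angles f :
  continuous f -> leb.-integrable (@angles R) (EFin \o f).
Proof.
move=> cf; have := continuous_integrable_segment cf.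
apply: integrableS => //; first exact: measurable_angles.
by apply: subset_itvl; rewrite bnd_simp.
Qed.

Lemma circle_meanD f g : continuous f -> continuous g ->
  circle_mean (fun t => f t + g t) = circle_mean f + circle_mean g.
Proof.
move=> cf cg; rewrite /circle_mean RintegralD ?mulrDr//;
  first [exact: measurable_angles | exact: continuous_integrable_angles].
Qed.

Lemma circle_meanZ (a : R) f : continuous f ->
  circle_mean (fun t => a * f t) = a * circle_mean f.
Proof.
move=> cf; rewrite /circle_mean RintegralZl//; first by rewrite mulrCA.
  exact: measurable_angles.
exact: continuous_integrable_angles.
Qed.

Lemma circle_mean_cst (a : R) : circle_mean (fun=> a) = a.
Proof.
rewrite /circle_mean Rintegral_cst; last exact: measurable_angles.
have -> : fine (leb (@angles R)) = 2 * pi by have /(congr1 fine) := lebesgue_angles.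
by rewrite mulrC mulfK// gt_eqF// twopi_gt0.
Qed.

Lemma le_circle_mean f g : continuous f -> continuous g ->
  (forall t, f t <= g t) -> circle_mean f <= circle_mean g.
Proof.
move=> cf cg fg; rewrite /circle_mean ler_pM2l ?invr_gt0 ?twopi_gt0//.
apply: le_Rintegral => //; first exact: measurable_angles.
  exact: continuous_integrable_angles.
exact: continuous_integrable_angles.
Qed.

Lemma circle_mean_sum (I : Type) (s : seq I) (F : I -> R -> R) :
  (forall i, continuous (F i)) ->
  circle_mean (fun t => \sum_(i <- s) F i t) = \sum_(i <- s) circle_mean (F i).
Proof.
move=> cF; elim: s => [|i s IH].
  by rewrite big_nil; under eq_fun do rewrite big_nil; rewrite circle_mean_cst.
rewrite big_cons -IH -circle_meanD//; last first.
  by apply: continuous_big => // x; exact: add_continuous.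
by congr circle_mean; apply/funext => t; rewrite big_cons.
Qed.

Lemma circle_mean_derive f F : continuous f ->
  (forall t : R, is_derive t 1 F (f t)) -> F (2 * pi) = F 0 -> circle_mean f = 0.
Proof.
move=> cf dF per; rewrite /circle_mean /angles.
rewrite Rintegral_itv_bndo_bndc; last exact: continuous_integrable_angles.
have cF : continuous F.
  move=> t; apply: differentiable_continuous; apply/derivable1_diffP.
  by have := dF t; case.
rewrite /Rintegral (@continuous_FTC2 _ f F) ?twopi_gt0//.
by rewrite per subee// mulr0.
exact: continuous_subspaceT.
split; first by move=> t _; have := dF t; case.
  by apply: cvg_at_right_filter; exact: cF.
  by apply: cvg_at_left_filter; exact: cF.
by move=> t _; rewrite derive1E; have := dF t => /(@derive_val _ _ _ _ _ _ _).
Qed.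

End CircleMean.

(** * Fourier expansion of the weight *)

Section TrigonometricWeight.
Variable R : realType.
Implicit Types (z u : R[i]) (t : R).

(** The real part of [z * expi (m t)]. The frequency is an integer because multiplication by the
    weight shifts it by up to 3 in both directions. *)
Definition trig_term z (m : int) t : R :=
  complex.Re z * cos (m%:~R * t) - complex.Im z * sin (m%:~R * t).

Definition weight t : R := (1 - cos t) ^+ 2 * (1 + cos t).

Lemma continuous_trig_term z m : continuous (trig_term z m).
Proof.
move=> t; apply: cvgB; apply: cvgM; try exact: cvg_cst.
  apply: (@continuous_comp _ _ _ (fun t : R => m%:~R * t) cos); last exact: continuous_cos.
  exact: mulrl_continuous.
apply: (@continuous_comp _ _ _ (fun t : R => m%:~R * t) sin); last exact: continuous_sin.
exact: mulrl_continuous.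
Qed.

Lemma continuous_weight : continuous weight.
Proof.
have c1 : continuous (fun t : R => 1 - cos t).
  by move=> t; apply: cvgB; [exact: cvg_cst|exact: continuous_cos].
move=> t; apply: cvgM; first by under eq_fun do rewrite expr2; apply: cvgM; exact: c1.
by apply: cvgD; [exact: cvg_cst|exact: continuous_cos].
Qed.

Lemma cos_2pi_int (m : int) : cos (m%:~R * (2 * pi)) = 1 :> R.
Proof.
have key n : cos (pi *+ 2 *+ n) = 1 :> R.
  by elim: n => [|n IH]; rewrite ?mulr0n ?cos0// mulrSr cosD IH cos2pi sin2pi mulr0 subr0 mulr1.
by case: m => n; rewrite ?NegzE ?mulrNz ?mulNr ?cosN -?pmulrn mulr_natl ?mulr_natl key.
Qed.

Lemma sin_2pi_int (m : int) : sin (m%:~R * (2 * pi)) = 0 :> R.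
Proof.
have h := cos2Dsin2 (m%:~R * (2 * pi) : R).
by apply/eqP; rewrite -sqrf_eq0; apply/eqP; move: h; rewrite cos_2pi_int expr1n; lra.
Qed.

Lemma circle_mean_trig_term z m :
  circle_mean (trig_term z m) = if m == 0 then complex.Re z else 0.
Proof.
have [->|m0] := eqVneq m 0.
  rewrite -[RHS]circle_mean_cst; congr circle_mean; apply/funext => t.
  by rewrite /trig_term mul0r cos0 sin0 mulr1 mulr0 subr0.
have mR : m%:~R != 0 :> R by rewrite intr_eq0.
pose F (t : R) := (complex.Re z / m%:~R) * sin (m%:~R * t)
                 + (complex.Im z / m%:~R) * cos (m%:~R * t).
apply: (circle_mean_derive (F := F)); first exact: continuous_trig_term.
  move=> t.
  have dl : is_derive t (1:R) (fun x : R => m%:~R * x) m%:~R.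
    by apply: is_derive_eq; rewrite /GRing.scale/= mulr1.
  have ds : is_derive t 1 (fun x : R => sin (m%:~R * x)) (cos (m%:~R * t) * m%:~R).
    by apply: (@is_derive1_comp _ sin (fun x : R => m%:~R * x)).
  have dc : is_derive t 1 (fun x : R => cos (m%:~R * x)) (- sin (m%:~R * t) * m%:~R).
    by apply: (@is_derive1_comp _ cos (fun x : R => m%:~R * x)).
  apply: is_derive_eq; rewrite /trig_term /GRing.scale/=.
  by field.
by rewrite /F cos_2pi_int sin_2pi_int [m%:~R * 0]mulr0 cos0 sin0.
Qed.

(** The weight is [1/2 - cos t / 4 - cos (2 t) / 2 + cos (3 t) / 4], and [2 cos (j t)] times a term
    of frequency [m] is the sum of those of frequencies [m + j] and [m - j]; hence the halved
    coefficients. *)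
Lemma weight_trig_term z m t : weight t * trig_term z m t =
  1/2 * trig_term z m t
  + - (1/8) * (trig_term z (m + 1) t + trig_term z (m - 1) t)
  + - (1/4) * (trig_term z (m + 2) t + trig_term z (m - 2) t)
  + 1/8 * (trig_term z (m + 3) t + trig_term z (m - 3) t).
Proof.
have pair (j : int) : trig_term z (m + j) t + trig_term z (m - j) t =
    2 * cos (j%:~R * t) * trig_term z m t.
  by rewrite /trig_term rmorphB rmorphD/= mulrBl mulrDl cosB sinB cosD sinD; ring.
have S2 : sin t ^+ 2 = 1 - cos t ^+ 2 by rewrite -(cos2Dsin2 t); ring.
have c2 : cos (2%:~R * t) = 2 * cos t ^+ 2 - 1.
  by rewrite (_ : 2%:~R * t = t + t); [rewrite cosD -!expr2 S2; ring|ring].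
have c3 : cos (3%:~R * t) = 4 * cos t ^+ 3 - 3 * cos t.
  rewrite (_ : 3%:~R * t = t + 2%:~R * t); last by ring.
  rewrite cosD c2 (_ : 2%:~R * t = t + t); last by ring.
  rewrite sinD; transitivity (cos t * (2 * cos t ^+ 2 - 1) - 2 * cos t * sin t ^+ 2); first by ring.
  by rewrite S2; ring.
by rewrite !pair c2 c3 [1%:~R * t]mul1r /weight; field.
Qed.

(** Fourier coefficients of the weight at the frequencies [k >= 0]; the default value of [nth] makes
    them vanish from 4 on. *)
Definition weight_coef (k : nat) : R := [:: 1/2; - (1/8); - (1/4); 1/8]`_k.

Lemma circle_mean_weight_trig_term z (k : nat) :
  circle_mean (fun t => weight t * trig_term z k t) = weight_coef k * complex.Re z.
Proof.
have ct m : continuous (trig_term z m) := @continuous_trig_term z m.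
under eq_fun do rewrite weight_trig_term.
have cmt m := circle_mean_trig_term z m.
move: (trig_term z) ct cmt => T ct cmt.
rewrite !(circle_meanD, circle_meanZ); do ?[exact: ct|apply: continuous_fD|apply: continuous_fZ].
rewrite !cmt /weight_coef.
by case: k => [|[|[|[|k]]]]; rewrite /= ?nth_nil ?subrr; ring.
Qed.

End TrigonometricWeight.

(** * Taylor expansion of [ln |1 - u|^2] by real calculus *)

Section LogJet.
Local Open Scope complex_scope.
Local Open Scope ring_scope.
Variable R : realType.
Implicit Types (z u : R[i]) (s t r : R).

(** The squared modulus as a real number, polynomial in the two parts: [ln] applies to it and
    identities fall to [ring]. *)
Definition sqnormc z : R := complex.Re z ^+ 2 + complex.Im z ^+ 2.

Lemma sqnormc_ge0 z : 0 <= sqnormc z.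
Proof. by rewrite addr_ge0// sqr_ge0. Qed.

Lemma sqnormc_normc z : sqnormc z = Normc.normc z ^+ 2.
Proof. by case: z => a b; rewrite /sqnormc/= sqr_sqrtr// addr_ge0// sqr_ge0. Qed.

Lemma normc_ge0 z : 0 <= Normc.normc z.
Proof. by case: z => a b; exact: sqrtr_ge0. Qed.

Lemma sqnormc_gt0 z : (0 < sqnormc z) = (z != 0).
Proof.
rewrite lt_neqAle sqnormc_ge0 andbT eq_sym sqnormc_normc sqrf_eq0.
by congr negb; apply/eqP/eqP => [/Normc.eq0_normc//|->]; exact: Normc.normc0.
Qed.

Lemma sqnormcM z u : sqnormc (z * u) = sqnormc z * sqnormc u.
Proof. by rewrite !sqnormc_normc Normc.normcM exprMn. Qed.

Lemma sqnormc_real r : sqnormc r%:C = r ^+ 2.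
Proof. by rewrite /sqnormc/= expr0n addr0. Qed.

Lemma mul_conjc z : z * conjc z = (sqnormc z)%:C.
Proof. by case: z => a b; rewrite /sqnormc; simpc; congr (_ +i* _); ring. Qed.

Lemma ler_Re_normc z : `|complex.Re z| <= Normc.normc z.
Proof.
rewrite -ler_sqr ?nnegrE ?normc_ge0// -sqnormc_normc real_normK ?num_real//.
by rewrite lerDl sqr_ge0.
Qed.

Lemma normcX z n : Normc.normc (z ^+ n) = Normc.normc z ^+ n.
Proof. by elim: n => [|n IH]; rewrite ?Normc.normc1// !exprS Normc.normcM IH. Qed.

Lemma normc_real r : Normc.normc r%:C = `|r|.
Proof. by rewrite /= expr0n addr0 sqrtr_sqr. Qed.

Lemma normcB_ge z u : Normc.normc z - Normc.normc u <= Normc.normc (z - u).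
Proof. by rewrite lerBlDr; apply: le_trans (le_normcD _ _); rewrite subrK. Qed.

Lemma is_derive_sqnormc_line u s :
  is_derive s 1 (fun s => sqnormc (1 - s%:C * u))
    (2 * (s * sqnormc u - complex.Re u)).
Proof.
case: u => a b.
have -> : (fun s => sqnormc (1 - s%:C * (a +i* b))) =
   (fun s : R => (1 - s * a) ^+ 2 + (s * b) ^+ 2).
  by apply/funext => x; rewrite /sqnormc/=; ring.
by apply: is_derive_eq; rewrite /sqnormc /GRing.scale/=; ring.
Qed.

(** The Taylor polynomial of degree [M] of [2 Re log (1 - u) = ln |1 - u|^2]. *)
Definition log_jet (M : nat) u : R :=
  - 2 * \sum_(k < M) complex.Re (u ^+ k.+1) / k.+1%:R.

Lemma Re_realM r z : complex.Re (r%:C * z) = r * complex.Re z.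
Proof. by case: z => a b /=; rewrite mul0r subr0. Qed.

(** The mean value theorem is applied to the error [g s] at the point [s u], for [s] in [0, 1]. This
    keeps to one real variable and avoids a complex logarithm. *)
Lemma ln_sqnormc_jet M u r : Normc.normc u <= r -> r < 1 ->
  `|ln (sqnormc (1 - u)) - log_jet M u| <= 2 * r ^+ M.+1 / (1 - r).
Proof.
move=> ur r1; have r0 := le_trans (normc_ge0 u) ur.
have N1 s : 0 <= s <= 1 -> 1 - r <= Normc.normc (1 - s%:C * u).
  move=> /andP[s0 s1]; apply: le_trans (normcB_ge _ _).
  rewrite Normc.normc1 Normc.normcM normc_real ger0_norm// lerB//.
  by apply: le_trans ur; rewrite ler_piMl// normc_ge0.
have Npos s : 0 <= s <= 1 -> 0 < sqnormc (1 - s%:C * u).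
  move=> /N1 h; rewrite sqnormc_normc exprn_gt0//; apply: lt_le_trans h.
  by rewrite subr_gt0.
pose g s := ln (sqnormc (1 - s%:C * u)) +
  2 * \sum_(k < M) (complex.Re (u ^+ k.+1) / k.+1%:R) * s ^+ k.+1.
pose dg s := (sqnormc (1 - s%:C * u))^-1 * (2 * (s * sqnormc u - complex.Re u)) +
  2 * \sum_(k < M) complex.Re (u ^+ k.+1) * s ^+ k.
have dgE s : 0 <= s <= 1 -> is_derive s 1 g (dg s).
  move=> s01.
  have d1 : is_derive s 1 (fun s => ln (sqnormc (1 - s%:C * u)))
      ((sqnormc (1 - s%:C * u))^-1 * (2 * (s * sqnormc u - complex.Re u))).
    apply: (@is_derive1_comp _ (@ln R) (fun s => sqnormc (1 - s%:C * u))).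
      exact/is_derive1_ln/Npos.
    exact: is_derive_sqnormc_line.
  have d2 (k : 'I_M) : is_derive s 1
      (fun s : R => (complex.Re (u ^+ k.+1) / k.+1%:R) * s ^+ k.+1)
      (complex.Re (u ^+ k.+1) * s ^+ k).
    have h := is_deriveZ (complex.Re (u ^+ k.+1) / k.+1%:R)
      (is_deriveX k.+1 (is_derive_id s (1 : R))).
    rewrite (_ : (fun s => _) =
      (complex.Re (u ^+ k.+1) / k.+1%:R) \*: (@id R ^+ k.+1)); last first.
      by apply/funext => x; rewrite exprfctE.
    apply: (is_derive_eq h); rewrite /GRing.scale/=.
    by rewrite mulr1 mulrA divfK// pnatr_eq0.
  have d3 : is_derive s 1
     (fun s : R => \sum_(k < M) (complex.Re (u ^+ k.+1) / k.+1%:R) * s ^+ k.+1)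
     (\sum_(k < M) complex.Re (u ^+ k.+1) * s ^+ k).
    rewrite (_ : (fun s => _) = \sum_(k < M) (fun s : R => (complex.Re (u ^+ k.+1) / k.+1%:R) * s ^+ k.+1)).
      exact: is_derive_sum.
    by apply/funext => x; rewrite fct_sumE.
  exact: is_deriveD d1 (is_deriveZ 2 d3).
have dg_le s : 0 <= s <= 1 -> `|dg s| <= 2 * r ^+ M.+1 / (1 - r).
  move=> s01; have /andP[s0 s1] := s01.
  set N := sqnormc (1 - s%:C * u).
  (* Summing the geometric series leaves [dg s = - 2 Re (u (s u)^M / (1 - s u))]; the factor
     [N = |1 - s u|^2] clears the denominator. *)
  have E : dg s * N = - 2 * complex.Re (u * (s%:C * u) ^+ M * conjc (1 - s%:C * u)).
    have Sg : \sum_(k < M) complex.Re (u ^+ k.+1) * s ^+ k =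
        complex.Re (u * \sum_(k < M) (s%:C * u) ^+ k).
      rewrite mulr_sumr raddf_sum; apply: eq_bigr => k _.
      by rewrite /= exprMn mulrCA -exprS -rmorphXn Re_realM mulrC.
    rewrite /dg mulrDl mulrAC mulVf ?gt_eqF ?Npos// mul1r Sg -[2 * _ * N]mulrA.
    have -> : complex.Re (u * \sum_(k < M) (s%:C * u) ^+ k) * N =
       complex.Re (u * conjc (1 - s%:C * u)) -
       complex.Re (u * (s%:C * u) ^+ M * conjc (1 - s%:C * u)).
      rewrite mulrC -Re_realM -mul_conjc -raddfB; congr (complex.Re _).
      transitivity (u * (1 - (s%:C * u) ^+ M) * conjc (1 - s%:C * u)); last by ring.
      have -> : 1 - (s%:C * u) ^+ M = (1 - s%:C * u) * \sum_(k < M) (s%:C * u) ^+ k.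
        by rewrite -opprB subrX1 -mulNr opprB.
      by ring.
    have -> : complex.Re (u * conjc (1 - s%:C * u)) = complex.Re u - s * sqnormc u.
      by case: {+}u => a b; rewrite /sqnormc/=; ring.
    by ring.
  have n0 : 0 < Normc.normc (1 - s%:C * u) by apply: lt_le_trans (N1 _ s01); rewrite subr_gt0.
  rewrite ler_pdivlMr ?subr_gt0//.
  apply: (@le_trans _ _ (`|dg s| * Normc.normc (1 - s%:C * u))).
    by rewrite ler_wpM2l// N1.
  rewrite -(ler_pM2r n0) -mulrA -expr2 -sqnormc_normc -/N.
  have N0 : 0 <= N by exact: sqnormc_ge0.
  rewrite -{1}(ger0_norm N0) -normrM E normrM normrN normr_nat -[leRHS]mulrA ler_pM2l//.
  apply: le_trans (ler_Re_normc _) _.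
  have -> : Normc.normc (u * (s%:C * u) ^+ M * conjc (1 - s%:C * u)) =
    Normc.normc u * (s * Normc.normc u) ^+ M * Normc.normc (1 - s%:C * u).
    rewrite !Normc.normcM normcX Normc.normcM normc_real ger0_norm//; congr (_ * _).
    by case: (1 - _) => a b /=; rewrite sqrrN.
  rewrite ler_pM2r// exprS ler_pM// ?normc_ge0// ?exprn_ge0// ?mulr_ge0 ?normc_ge0//.
  rewrite lerXn2r ?nnegrE ?mulr_ge0 ?normc_ge0//.
  by apply: le_trans ur; rewrite ler_piMl// normc_ge0.
have [||c c01 ge] := @MVT R g dg 0 1 ltr01.
  by move=> s; rewrite in_itv/= => /andP[s0 s1]; apply: dgE; rewrite !ltW.
  apply: derivable_within_continuous => s; rewrite in_itv/= => s01.
  by have := dgE _ s01; case.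
have -> : ln (sqnormc (1 - u)) - log_jet M u = g 1 - g 0.
  rewrite /g mul1r; under eq_bigr do rewrite expr1n mulr1.
  under [X in _ = _ - (_ + 2 * X)]eq_bigr do rewrite expr0n mulr0.
  rewrite mul0r subr0 sqnormc_real expr1n ln1 big1_eq mulr0 addr0 subr0.
  by rewrite /log_jet mulNr opprK.
rewrite ge subr0 mulr1; apply: dg_le.
by move: c01; rewrite in_itv/= => /andP[? ?]; rewrite !ltW.
Qed.

End LogJet.

(** * Weighted mean of the logarithm of a linear factor *)

Section LogMean.
Variable R : realType.
Local Open Scope complex_scope.
Local Open Scope ring_scope.
Implicit Types (p q : {poly R[i]}) (z u : R[i]) (s t r : R).

Lemma expiX t k : expi t ^+ k = expi (k%:R * t).
Proof.
elim: k => [|k IH]; first by rewrite mul0r /expi cos0 sin0.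
rewrite exprSr IH -[in RHS]natr1 mulrDl mul1r /expi cosD sinD; simpc.
by congr (_ +i* _); rewrite addrC.
Qed.

Lemma normc_expi t : Normc.normc (expi t) = 1.
Proof. by rewrite /= cos2Dsin2 sqrtr1. Qed.

Lemma Re_expX_trig_term z t k :
  complex.Re ((z * expi t) ^+ k) = trig_term (z ^+ k) k t.
Proof.
rewrite exprMn expiX /trig_term /expi -pmulrn.
by case: (z ^+ k) => a b.
Qed.

Lemma continuous_horner_expi p :
  continuous (fun t => complex.Re p.[expi t]) /\
  continuous (fun t => complex.Im p.[expi t]).
Proof.
elim/poly_ind: p => [|p c [IHr IHi]].
  by split; under eq_fun do rewrite horner0; move=> x; exact: cvg_cst.
have cc : continuous (@cos R) by exact: continuous_cos.
have cs : continuous (@sin R) by exact: continuous_sin.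
split.
  rewrite (_ : (fun t => _) = (fun t => (complex.Re p.[expi t] * cos t +
      (-1) * (complex.Im p.[expi t] * sin t)) + complex.Re c)); last first.
    apply/funext => t; rewrite hornerMXaddC /expi.
    by case: (p.[_]) => a b; case: {+}c => c1 c2 /=; ring.
  apply: continuous_fD; last by move=> x; exact: cvg_cst.
  by apply: continuous_fD; [exact: continuous_fM|apply: continuous_fZ; exact: continuous_fM].
rewrite (_ : (fun t => _) = (fun t => (complex.Re p.[expi t] * sin t +
    (complex.Im p.[expi t] * cos t)) + complex.Im c)); last first.
  apply/funext => t; rewrite hornerMXaddC /expi.
  by case: (p.[_]) => a b; case: {+}c => c1 c2 /=; ring.
apply: continuous_fD; last by move=> x; exact: cvg_cst.
by apply: continuous_fD; exact: continuous_fM.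
Qed.

Lemma continuous_sqnormc_horner p : continuous (fun t => sqnormc p.[expi t]).
Proof.
have [cr ci] := continuous_horner_expi p; rewrite /sqnormc.
under eq_fun do rewrite !expr2.
by apply: continuous_fD; exact: continuous_fM.
Qed.

Lemma continuous_ln_sqnormc p : (forall t, p.[expi t] != 0) ->
  continuous (fun t => ln (sqnormc p.[expi t])).
Proof.
move=> p0 t; apply: (@continuous_comp _ _ _ (fun t => sqnormc p.[expi t]) (@ln R)).
  exact: continuous_sqnormc_horner.
by apply: continuous_ln; rewrite sqnormc_gt0.
Qed.

Lemma weight_ge0 t : 0 <= weight t.
Proof. by rewrite mulr_ge0 ?sqr_ge0// -lerBlDl sub0r cos_geN1. Qed.

Lemma weight_le2 t : weight t <= 2.
Proof.
rewrite /weight; have := cos_geN1 t; have := cos_le1 t.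
by move: (cos t) => c h1 h2; nra.
Qed.

Lemma eq_geometric_bound (x y C r : R) : 0 <= r < 1 ->
  (forall n : nat, `|x - y| <= C * r ^+ n) -> x = y.
Proof.
move=> /andP[r0 r1] h; apply/eqP; rewrite -subr_eq0 -normr_le0 leNgt; apply/negP => xy.
have rn : `|r| < 1 by rewrite ger0_norm.
have := cvgr_lt _ (@cvg_geometric R C r rn) _ xy.
move=> [N _ /(_ N (leqnn N))]; rewrite /geometric/=.
by rewrite ltNge h.
Qed.

(** All jets of degree at least 3 have the same weighted mean, since [weight_coef] vanishes beyond
    3, and they approach the logarithm uniformly at a geometric rate; so limit and integral need not
    be exchanged. The coefficients on the right are [- 2 / k * weight_coef k]. *)
Lemma circle_mean_ln_factor z : Normc.normc z < 1 ->
  circle_mean (fun t => weight t * ln (sqnormc (1 - z * expi t))) =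
  complex.Re z / 4 + complex.Re (z ^+ 2) / 4 - complex.Re (z ^+ 3) / 12.
Proof.
set r := Normc.normc z => r1; have r0 : 0 <= r by exact: normc_ge0.
set c := RHS.
have cw := @continuous_weight R.
have jetE n t : weight t * log_jet (3 + n) (z * expi t) =
  \sum_(k < 3 + n) (- 2 / k.+1%:R) * (weight t * trig_term (z ^+ k.+1) k.+1 t).
  rewrite /log_jet mulrCA !mulr_sumr; apply: eq_bigr => k _.
  by rewrite Re_expX_trig_term; ring.
have cjet n : continuous (fun t => weight t * log_jet (3 + n) (z * expi t)).
  under eq_fun do rewrite jetE.
  apply: continuous_big => [|k _]; first exact: add_continuous.
  by apply: continuous_fZ; apply: continuous_fM => //; exact: continuous_trig_term.
have jet_mean n : circle_mean (fun t => weight t * log_jet (3 + n) (z * expi t)) = c.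
  under eq_fun do rewrite jetE.
  rewrite circle_mean_sum; last first.
    move=> k; apply: continuous_fZ; apply: continuous_fM => //; exact: continuous_trig_term.
  under eq_bigr => k _.
    rewrite circle_meanZ; last by apply: continuous_fM => //; exact: continuous_trig_term.
    rewrite circle_mean_weight_trig_term.
    over.
  rewrite big_split_ord/= [X in _ + X]big1 ?addr0; last first.
    by move=> k _; rewrite /weight_coef/= nth_nil mul0r mulr0.
  by rewrite !big_ord_recr big_ord0 /weight_coef/= /c expr1; field.
have cln : continuous (fun t => weight t * ln (sqnormc (1 - z * expi t))).
  apply: continuous_fM => //.
  have E t : 1 - z * expi t = (1 - z *: 'X).[expi t].
    by rewrite !hornerE.
  under eq_fun do rewrite E.
  apply: continuous_ln_sqnormc => t; rewrite -E subr_eq0; apply/eqP => e.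
  have := congr1 (@Normc.normc R) e.
  by rewrite Normc.normcM normc_expi mulr1 Normc.normc1 => e1; move: r1; rewrite /r -e1 ltxx.
(* The 4 is the bound 2 on the weight times the 2 in the jet error. *)
apply: (@eq_geometric_bound _ _ (4 / (1 - r)) r) => [|n]; first by rewrite r0.
have b t : `|weight t * ln (sqnormc (1 - z * expi t)) - weight t * log_jet (3 + n) (z * expi t)|
    <= 4 / (1 - r) * r ^+ n.
  rewrite -mulrBr normrM ger0_norm ?weight_ge0//.
  have h : `|ln (sqnormc (1 - z * expi t)) - log_jet (3 + n) (z * expi t)|
      <= 2 / (1 - r) * r ^+ n.
    apply: (le_trans (ln_sqnormc_jet (3 + n) (r := r) _ r1)).
      by rewrite Normc.normcM normc_expi mulr1.
    rewrite mulrAC ler_wpM2l//.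
      by rewrite divr_ge0// subr_ge0 ltW.
    by rewrite ler_wiXn2l// ?ltW// -addSn leq_addl.
  apply: (le_trans (ler_pM (weight_ge0 t) (normr_ge0 _) (weight_le2 t) h)).
  by rewrite !mulrA -natrM.
rewrite -(jet_mean n) ler_norml; apply/andP; split.
  rewrite lerBrDl -[X in _ + X](circle_mean_cst) -circle_meanD//; last by move=> x; exact: cvg_cst.
  apply: le_circle_mean => //.
    by apply: continuous_fD => //; move=> x; exact: cvg_cst.
  by move=> t; have := b t; rewrite ler_norml => /andP[+ _]; rewrite lerBrDl.
rewrite lerBlDl -[X in _ + X](circle_mean_cst) -circle_meanD//; last by move=> x; exact: cvg_cst.
apply: le_circle_mean => //.
  by apply: continuous_fD => //; move=> x; exact: cvg_cst.
by move=> t; have := b t; rewrite ler_norml => /andP[_ +]; rewrite lerBlDl.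
Qed.

End LogMean.

(** * A weighted Jensen formula for polynomials without zeros in the closed disc *)

Section SzegoMean.
Variable R : realType.
Local Open Scope complex_scope.
Local Open Scope ring_scope.
Implicit Types (p q : {poly R[i]}) (z u : R[i]) (s t r : R).

Lemma Re_divn u n : complex.Re (u / n%:R) = complex.Re u / n%:R.
Proof.
by rewrite -(rmorph_nat (real_complex R)) -fmorphV mulrC Re_realM mulrC.
Qed.

(* Taylor coefficients of log (q / q`_0) at the origin, for q`_0 != 0 *)
Definition log_coef1 q := q`_1 / q`_0.
Definition log_coef2 q := q`_2 / q`_0 - log_coef1 q ^+ 2 / 2.
Definition log_coef3 q :=
  q`_3 / q`_0 - q`_1 * q`_2 / q`_0 ^+ 2 + log_coef1 q ^+ 3 / 3.

(** The logarithm of a product is a sum; with the coefficients written out this becomes a rational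
    identity in the first four coefficients of each factor. *)
Lemma log_coefM p q : p`_0 != 0 -> q`_0 != 0 ->
  [/\ log_coef1 (p * q) = log_coef1 p + log_coef1 q,
      log_coef2 (p * q) = log_coef2 p + log_coef2 q &
      log_coef3 (p * q) = log_coef3 p + log_coef3 q].
Proof.
move=> p0 q0; rewrite /log_coef3 /log_coef2 /log_coef1 !coefM !big_ord_recr !big_ord0/=.
move: (p`_0) (p`_1) (p`_2) (p`_3) (q`_0) (q`_1) (q`_2) (q`_3) p0 q0.
by move=> a b c d e f g h a0 e0; split; field; rewrite a0 e0.
Qed.

(** With [l_k] the Taylor coefficients of [log q], [ln |q|^2] on the circle is [ln |q(0)|^2] plus
    the sum of [2 Re (l_k expi (k t))]. Pairing it with the weight gives 1/2 and the numbers
    [2 * weight_coef k], that is -1/4, -1/2 and 1/4. *)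
Definition log_mean q : R := ln (sqnormc q`_0) / 2 - complex.Re (log_coef1 q) / 4
  - complex.Re (log_coef2 q) / 2 + complex.Re (log_coef3 q) / 4.

Lemma log_meanM p q : p`_0 != 0 -> q`_0 != 0 ->
  log_mean (p * q) = log_mean p + log_mean q.
Proof.
move=> p0 q0; have [e1 e2 e3] := log_coefM p0 q0.
rewrite /log_mean e1 e2 e3 !raddfD/= coef0M sqnormcM lnM ?posrE ?sqnormc_gt0//.
by field.
Qed.

Definition circle_log_mean q :=
  circle_mean (fun t => weight t * ln (sqnormc q.[expi t])).

Lemma circle_log_meanM p q : (forall t, p.[expi t] != 0) ->
  (forall t, q.[expi t] != 0) ->
  circle_log_mean (p * q) = circle_log_mean p + circle_log_mean q.
Proof.
move=> p0 q0; rewrite /circle_log_mean -circle_meanD; first last.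
by apply: continuous_fM; [exact: continuous_weight|exact: continuous_ln_sqnormc].
by apply: continuous_fM; [exact: continuous_weight|exact: continuous_ln_sqnormc].
congr circle_mean; apply/funext => t.
by rewrite hornerM sqnormcM lnM ?posrE ?sqnormc_gt0// mulrDr.
Qed.

Lemma circle_log_meanC (c : R[i]) : circle_log_mean c%:P = log_mean c%:P.
Proof.
rewrite /circle_log_mean /log_mean /log_coef3 /log_coef2 /log_coef1 !coefC/=.
under eq_fun do rewrite hornerC mulrC.
rewrite circle_meanZ; last exact: continuous_weight.
have -> : circle_mean (@weight R) = 1 / 2.
  have := circle_mean_weight_trig_term (1 : R[i]) 0; rewrite /weight_coef/= mulr1 => <-.
  congr circle_mean; apply/funext => t.
  by rewrite /trig_term/= mul0r cos0 sin0 mulr0 subr0 !mulr1.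
by rewrite !(mul0r, mulr0, expr0n, subr0, addr0)/= !(mul0r, subr0, addr0, mul1r).
Qed.

(** Writing [X - z = - z (1 - X / z)] leaves a constant and a linear factor whose parameter [1 / z]
    lies inside the disc. *)
Lemma circle_log_mean_XsubC z : 1 < Normc.normc z ->
  circle_log_mean ('X - z%:P) = log_mean ('X - z%:P).
Proof.
move=> z1; have z0 : z != 0.
  by apply/eqP => e; move: z1; rewrite e Normc.normc0 ltNge ler01.
have zi1 : Normc.normc z^-1 < 1 by rewrite Normc.normcV invf_lt1// (lt_trans ltr01).
have zi t : (1 - z^-1 *: 'X).[expi t] != 0.
  rewrite !hornerE subr_eq0; apply/eqP => e; have := congr1 (@Normc.normc R) e.
  by rewrite Normc.normcM normc_expi mulr1 Normc.normc1 => e1; move: zi1; rewrite -e1 ltxx.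
have -> : 'X - z%:P = (- z)%:P * (1 - z^-1 *: 'X).
  by rewrite mul_polyC scalerBr scalerA mulNr divff// scaleN1r opprK alg_polyC polyCN addrC.
rewrite circle_log_meanM//; last by move=> t; rewrite hornerC oppr_eq0.
rewrite log_meanM; first last.
by rewrite coefB coef1 coefZ coefX mulr0 subr0 oner_eq0.
by rewrite coefC oppr_eq0.
rewrite circle_log_meanC; congr (_ + _).
have -> : circle_log_mean (1 - z^-1 *: 'X) =
    circle_mean (fun t => weight t * ln (sqnormc (1 - z^-1 * expi t))).
  by congr circle_mean; apply/funext => t; rewrite !hornerE.
rewrite circle_mean_ln_factor// /log_mean /log_coef3 /log_coef2 /log_coef1.
rewrite !coefB !coefZ !coef1 !coefX/= !(mulr0, mulr1, subr0, sub0r) sqnormc_real.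
rewrite !expr1n ln1 !mul0r !divr1 !sub0r oppr0 add0r sqrrN !raddfN/= !Re_divn exprNn -signr_odd/= expr1.
by rewrite mulN1r raddfN/=; field.
Qed.

Theorem circle_log_meanE q : (forall z, Normc.normc z <= 1 -> q.[z] != 0) ->
  circle_log_mean q = log_mean q.
Proof.
have [rs qE] := closed_field_poly_normal q => h.
have lc0 : lead_coef q != 0.
  rewrite lead_coef_eq0; apply/eqP => q0.
  by have := h 0; rewrite Normc.normc0 ler01 => /(_ isT); rewrite q0 horner0 eqxx.
have rs1 z : z \in rs -> 1 < Normc.normc z.
  move=> zrs; rewrite ltNge; apply/negP => /h/negP; apply; rewrite -/(root q z) qE rootZ//.
  by rewrite root_prod_XsubC zrs.
have on_circle t z : 1 < Normc.normc z -> ('X - z%:P).[expi t] != 0.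
  move=> z1; rewrite hornerXsubC subr_eq0; apply/eqP => e.
  by move: z1; rewrite -e normc_expi ltxx.
have at0 z : 1 < Normc.normc z -> ('X - z%:P)`_0 != 0.
  move=> z1; rewrite coefB coefX coefC/= sub0r oppr_eq0; apply/eqP => e.
  by move: z1; rewrite e Normc.normc0 ltNge ler01.
have [pc p0 pm] : let p := \prod_(z <- rs) ('X - z%:P) in
    [/\ forall t, p.[expi t] != 0, p`_0 != 0 & circle_log_mean p = log_mean p].
  elim: rs rs1 {qE} => [|z rs IH] rs1.
    rewrite big_nil; split; last exact: circle_log_meanC.
      by move=> t; rewrite hornerC oner_eq0.
    by rewrite coef1 oner_eq0.
  have z1 : 1 < Normc.normc z by rewrite rs1// mem_head.
  have [|pc p0 pm] := IH; first by move=> u urs; rewrite rs1// inE urs orbT.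
  rewrite big_cons; split.
    by move=> t; rewrite hornerM mulf_neq0// on_circle.
    by rewrite coef0M mulf_neq0// at0.
  rewrite circle_log_meanM//; last by move=> t; exact: on_circle.
  by rewrite log_meanM ?at0// pm circle_log_mean_XsubC.
rewrite qE -mul_polyC circle_log_meanM//; last by move=> t; rewrite hornerC.
by rewrite log_meanM ?coefC//= circle_log_meanC pm.
Qed.

End SzegoMean.

(** * The Szego recursion with real coefficients *)

Section SzegoRecursion.
Variable R : realType.
Local Open Scope complex_scope.
Local Open Scope ring_scope.
Implicit Types (P Q : {poly R[i]}) (z u : R[i]) (s t r x : R).

Lemma coef_revpoly n P i : (revpoly n P)`_i = if (i <= n)%N then (P`_(n - i))^* else 0.
Proof. by rewrite coef_poly ltnS. Qed.

Lemma revpolyZ n z P : revpoly n (z *: P) = z^* *: revpoly n P.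
Proof.
apply/polyP => i; rewrite coefZ !coef_revpoly coefZ; case: ifP => _.
  exact: rmorphM.
by rewrite mulr0.
Qed.

Lemma revpolyB n P Q : revpoly n (P - Q) = revpoly n P - revpoly n Q.
Proof.
apply/polyP => i; rewrite coefB !coef_revpoly coefB; case: ifP => _.
  exact: rmorphB.
by rewrite subr0.
Qed.

Lemma revpolyXl n P : revpoly n.+1 ('X * P) = revpoly n P.
Proof.
apply/polyP => i; rewrite !coef_revpoly coefXM.
case: (ltngtP i n.+1) => [| |->].
  by rewrite ltnS => le_in; rewrite le_in subSn.
  by move=> lt_ni; rewrite leqNgt (ltnW lt_ni).
  by rewrite subnn ltnn rmorph0.
Qed.

(** The outer reversal is taken one degree higher, as the recursion for [q n.+1] requires; this is
    where the factor ['X] comes from. *)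
Lemma revpoly_revpoly n P : (size P <= n.+1)%N ->
  revpoly n.+1 (revpoly n P) = 'X * P.
Proof.
move=> sP; apply/polyP => i; rewrite coef_revpoly coefXM.
case: i => [|i] /=; first by rewrite subn0 coef_revpoly ltnn rmorph0.
case: ltnP => [lt_in|le_ni]; last by rewrite nth_default// (leq_trans sP).
by rewrite subSS coef_revpoly leq_subr subKn// conjCK.
Qed.

(** Up to the factor [rho], the matrix of a recursion step lies in SU(1,1), so it preserves the form
    [|z|^2 - |u|^2]. *)
Lemma sqnormc_szego (a : R) z u :
  sqnormc (z - a%:C * u) - sqnormc (u - a%:C * z) =
  (1 - a ^+ 2) * (sqnormc z - sqnormc u).
Proof. by case: z => z1 z2; case: u => u1 u2; rewrite /sqnormc/=; ring. Qed.

Lemma szego_neq0 (a : R) z u : `|a| < 1 -> sqnormc u <= sqnormc z -> z != 0 ->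
  z - a%:C * u != 0.
Proof.
move=> a1 uz z0; rewrite -sqnormc_gt0 sqnormc_normc exprn_gt0//.
apply: lt_le_trans (normcB_ge _ _); rewrite Normc.normcM normc_real subr_gt0.
have zn : 0 < Normc.normc z.
  by rewrite lt_def normc_ge0 andbT; apply: contra_neq z0 => /Normc.eq0_normc.
apply: (@le_lt_trans _ _ (`|a| * Normc.normc z)); last by rewrite gtr_pMl.
by rewrite ler_wpM2l// -ler_sqr ?nnegrE ?normc_ge0// -!sqnormc_normc.
Qed.

Variables (a : nat -> R) (p : nat -> {poly R[i]}).
Hypothesis a_lt1 : forall n, `|a n| < 1.
Hypothesis p0 : p 0%N = 1.
Hypothesis p_rec : forall n, 'X * p n =
  (Num.sqrt (1 - a n ^+ 2))%:C *: p n.+1 + (a n)%:C *: revpoly n (p n).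

Local Notation rho n := (Num.sqrt (1 - a n ^+ 2)).
Local Notation q n := (revpoly n (p n)).

Lemma one_sub_sqr_gt0 n : 0 < 1 - a n ^+ 2.
Proof. by rewrite subr_gt0 -real_normK ?num_real// expr_lt1. Qed.

Lemma rho_gt0 n : 0 < rho n.
Proof. by rewrite sqrtr_gt0 one_sub_sqr_gt0. Qed.

Lemma p_recE n : p n.+1 = (rho n)^-1%:C *: ('X * p n - (a n)%:C *: q n).
Proof.
rewrite p_rec addrK scalerA -rmorphM mulVf ?scale1r//.
by rewrite gt_eqF// rho_gt0.
Qed.

Lemma size_p n : (size (p n) <= n.+1)%N.
Proof.
elim: n => [|n IH]; first by rewrite p0 size_poly1.
rewrite p_recE (leq_trans (size_scale_leq _ _))// (leq_trans (size_polyD _ _))//.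
rewrite geq_max size_polyN (leq_trans (size_polyMleq _ _)) ?size_polyX//=.
rewrite (leq_trans (size_scale_leq _ _))// (leq_trans (size_poly _ _))//.
Qed.

Lemma q_recE n : q n.+1 = (rho n)^-1%:C *: (q n - (a n)%:C *: ('X * p n)).
Proof.
rewrite {1}p_recE revpolyZ revpolyB revpolyXl revpolyZ revpoly_revpoly ?size_p//.
by rewrite ![_^*]conjc_real.
Qed.

Lemma q0 : q 0 = 1.
Proof.
apply/polyP => i; rewrite coef_revpoly leqn0 p0 coef1.
by case: eqP => // ->; rewrite coef1 rmorph1.
Qed.

(** One step of the Christoffel-Darboux formula. By induction it gives [|p n| <= |q n|] in the
    closed disc and equality on the circle. *)
Lemma sqnormc_pq n z :
  sqnormc (q n.+1).[z] - sqnormc (p n.+1).[z] =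
  sqnormc (q n).[z] - sqnormc z * sqnormc (p n).[z].
Proof.
rewrite q_recE p_recE !hornerZ !hornerD !hornerN !hornerZ !hornerM hornerX.
rewrite !sqnormcM -mulrBr sqnormc_szego sqnormcM sqnormc_real mulrA exprVn sqr_sqrtr ?ltW ?one_sub_sqr_gt0//.
by rewrite mulVf ?mul1r// gt_eqF// one_sub_sqr_gt0.
Qed.

Lemma sqnormc_p_le_q n z : Normc.normc z <= 1 ->
  sqnormc (p n).[z] <= sqnormc (q n).[z].
Proof.
move=> z1; elim: n => [|n IH]; first by rewrite q0 p0.
rewrite -subr_ge0 sqnormc_pq subr_ge0; apply: le_trans IH.
by rewrite ler_piMl ?sqnormc_ge0// sqnormc_normc expr_le1// normc_ge0.
Qed.

Lemma q_neq0 n z : Normc.normc z <= 1 -> (q n).[z] != 0.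
Proof.
move=> z1; elim: n => [|n IH]; first by rewrite q0 hornerC oner_eq0.
rewrite q_recE hornerZ hornerD hornerN hornerZ hornerM hornerX mulf_neq0//.
  by rewrite -sqnormc_gt0 sqnormc_real exprn_gt0// invr_gt0 rho_gt0.
apply: szego_neq0 => //; rewrite sqnormcM; apply: le_trans (sqnormc_p_le_q n z1).
by rewrite ler_piMl ?sqnormc_ge0// sqnormc_normc expr_le1// normc_ge0.
Qed.

Lemma sqnormc_q_circle n z : Normc.normc z = 1 ->
  sqnormc (q n).[z] = sqnormc (p n).[z].
Proof.
move=> z1; apply/eqP; rewrite -subr_eq0; elim: n => [|n IH].
  by rewrite q0 p0 subrr.
by rewrite sqnormc_pq [sqnormc z]sqnormc_normc z1 expr1n mul1r.
Qed.

Hypothesis a_odd : forall n, a n.*2.+1 = 0.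

(** At an odd index the step is trivial: [rho] is 1, [q] is unchanged and [p] gains a factor
    ['X]. *)
Lemma pq_rec2 k :
  q k.+1.*2 = (rho k.*2)^-1%:C *: (q k.*2 - (a k.*2)%:C *: ('X * p k.*2)) /\
  p k.+1.*2 = (rho k.*2)^-1%:C *: ('X * ('X * p k.*2 - (a k.*2)%:C *: q k.*2)).
Proof.
have e : (rho k.*2.+1)^-1%:C = 1 :> R[i] by rewrite a_odd expr0n subr0 sqrtr1 invr1.
split; rewrite doubleS.
  by rewrite q_recE e a_odd scale1r scale0r subr0 q_recE.
by rewrite p_recE e a_odd scale1r scale0r subr0 p_recE scalerAr.
Qed.

(** The hypotheses say [P = - b X Q + O(X^3)], [b] being the previous even coefficient. Then
    [Q' = d Q (1 + b c X^2) + O(X^4)], so up to order 3 only the constant term and the second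
    coefficient of the logarithm change. Since [X^2 P = O(X^3)] and [Q' = d Q + O(X^2)], the
    invariant passes to [P'] and [Q'] with [c] in place of [b]. *)
Lemma log_mean_szego_step (b c d : R) P Q :
  Q`_0 != 0 -> d != 0 -> P`_0 = 0 -> P`_1 = - b%:C * Q`_0 -> P`_2 = - b%:C * Q`_1 ->
  let Q' := d%:C *: (Q - c%:C *: ('X * P)) in
  let P' := d%:C *: ('X * ('X * P - c%:C *: Q)) in
  [/\ [/\ Q'`_0 != 0, P'`_0 = 0, P'`_1 = - c%:C * Q'`_0 & P'`_2 = - c%:C * Q'`_1] &
      log_mean Q' = log_mean Q + ln (d ^+ 2) / 2 - b * c / 2].
Proof.
move=> Q0 d0 P0 P1 P2 Q' P'.
have dC : d%:C != 0 by rewrite -sqnormc_gt0 sqnormc_real exprn_even_gt0.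
have e0 : Q'`_0 = d%:C * Q`_0.
  by rewrite /Q' !(coefZ, coefB, coefXM)/= mulr0 subr0.
have e1 : Q'`_1 = d%:C * Q`_1.
  by rewrite /Q' !(coefZ, coefB, coefXM)/= P0 mulr0 subr0.
have e2 : Q'`_2 = d%:C * (Q`_2 + (b * c)%:C * Q`_0).
  by rewrite /Q' !(coefZ, coefB, coefXM)/= P1 rmorphM/=; ring.
have e3 : Q'`_3 = d%:C * (Q`_3 + (b * c)%:C * Q`_1).
  by rewrite /Q' !(coefZ, coefB, coefXM)/= P2 rmorphM/=; ring.
split; first split.
  by rewrite e0 mulf_neq0.
  by rewrite /P' !(coefZ, coefB, coefXM)/= mulr0.
  by rewrite e0 /P' !(coefZ, coefB, coefXM)/=; ring.
  by rewrite e1 /P' !(coefZ, coefB, coefXM)/= P0; ring.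
have E1 : log_coef1 Q' = log_coef1 Q.
  by rewrite /log_coef1 e0 e1; field; rewrite dC Q0.
have E2 : log_coef2 Q' = log_coef2 Q + (b * c)%:C.
  by rewrite /log_coef2 E1 e0 e2; field; rewrite dC Q0.
have E3 : log_coef3 Q' = log_coef3 Q.
  by rewrite /log_coef3 E1 e0 e1 e2 e3; field; rewrite dC Q0.
rewrite /log_mean E1 E2 E3 e0 sqnormcM sqnormc_real raddfD/= lnM ?posrE ?sqnormc_gt0 ?exprn_even_gt0//.
by field.
Qed.

(** The induction carries the invariant of [log_mean_szego_step]. It starts at 4 because the
    invariant fails at 2: the coefficient of order 2 in [p 2] still comes from the constant term of
    [p 0 = 1]. *)
Lemma log_mean_q k : log_mean (q k.+2.*2) = log_mean (q 4) +
  \sum_(j < k) (- ln (1 - a j.+2.*2 ^+ 2) - a j.+1.*2 * a j.+2.*2) / 2.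
Proof.
suff [] : [/\ (q k.+2.*2)`_0 != 0, (p k.+2.*2)`_0 = 0,
    (p k.+2.*2)`_1 = - (a k.+1.*2)%:C * (q k.+2.*2)`_0 &
    (p k.+2.*2)`_2 = - (a k.+1.*2)%:C * (q k.+2.*2)`_1] /\
  log_mean (q k.+2.*2) = log_mean (q 4) +
  \sum_(j < k) (- ln (1 - a j.+2.*2 ^+ 2) - a j.+1.*2 * a j.+2.*2) / 2 by [].
elim: k => [|k [[h0 h1 h2 h3] IH]].
  rewrite big_ord0 addr0; split=> //.
  have [q2 p2] := pq_rec2 0; have [q4 p4] := pq_rec2 1.
  have e : (p 1.*2)`_0 = 0 by rewrite p2 coefZ coefXM mulr0.
  split.
    by rewrite -horner_coef0 q_neq0// Normc.normc0.
    by rewrite p4 coefZ coefXM mulr0.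
    by rewrite q4 p4 !(coefZ, coefB, coefXM)/=; ring.
    by rewrite q4 p4 !(coefZ, coefB, coefXM)/= e; ring.
have [q' p'] := pq_rec2 k.+2.
have d0 : (rho k.+2.*2)^-1 != 0 by rewrite invr_eq0 gt_eqF// rho_gt0.
have [[g0 g1 g2 g3] g] := log_mean_szego_step (a k.+2.*2) h0 d0 h1 h2 h3.
rewrite -q' -p' in g0 g1 g2 g3 g; split=> //.
rewrite g IH big_ord_recr/= exprVn sqr_sqrtr ?ltW ?one_sub_sqr_gt0//.
rewrite lnV ?posrE ?one_sub_sqr_gt0//.
by field.
Qed.

End SzegoRecursion.

(** * Summability of the given coefficients and divergence of the gains *)

Section VerblunskySequence.
Variable R : realType.
Local Open Scope complex_scope.
Local Open Scope ring_scope.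
Implicit Types (n k : nat).

(** The even-index values of [alpha], extended to all indices so that they decrease and their
    differences telescope. *)
Definition envelope n : R := 2 / (3 * n.+1%:R `^ 4^-1).

Definition alphaR n : R := if odd n then 0 else envelope n.

Lemma alphaE n : alpha R n = (alphaR n)%:C.
Proof.
rewrite /alpha /alphaR /envelope -signr_odd; case: odd; rewrite ?expr1 ?expr0//.
by rewrite subrr mul0r.
Qed.

Lemma rootX4 n : (n.+1%:R `^ 4^-1) ^+ 4 = n.+1%:R :> R.
Proof. by rewrite -powR_mulrn ?powR_ge0// -powRrM mulVf ?powRr1// pnatr_eq0. Qed.

Lemma root_ge1 n : 1 <= n.+1%:R `^ 4^-1 :> R.
Proof.
have h : (1 : R) `^ 4^-1 <= n.+1%:R `^ 4^-1; last by rewrite powR1 in h.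
apply: ge0_ler_powR; rewrite ?nnegrE ?ler1n//.
Qed.

Lemma envelope_gt0 n : 0 < envelope n.
Proof. by rewrite divr_gt0// mulr_gt0// powR_gt0. Qed.

Lemma envelope_lt1 n : envelope n < 1.
Proof.
have h := root_ge1 n; rewrite /envelope ltr_pdivrMr ?mulr_gt0 ?powR_gt0//.
by lra.
Qed.

Lemma envelope_nonincr m n : (m <= n)%N -> envelope n <= envelope m.
Proof.
move=> mn; rewrite /envelope ler_pM2l// lef_pV2 ?posrE ?mulr_gt0 ?powR_gt0//.
by rewrite ler_pM2l//; apply: ge0_ler_powR; rewrite ?nnegrE// ler_nat.
Qed.

Lemma envelopeX4 n : envelope n ^+ 4 = 16 / (81 * n.+1%:R).
Proof. by rewrite /envelope expr_div_n exprMn rootX4; congr (_ / (_ * _)); ring. Qed.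

Lemma alphaR_norm_lt1 n : `|alphaR n| < 1.
Proof.
rewrite /alphaR; case: odd; first by rewrite normr0.
by rewrite gtr0_norm ?envelope_gt0 ?envelope_lt1.
Qed.

Lemma alphaR_even k : alphaR k.*2 = envelope k.*2.
Proof. by rewrite /alphaR odd_double. Qed.

Lemma alphaR_odd k : alphaR k.*2.+1 = 0.
Proof. by rewrite /alphaR/= odd_double. Qed.

Lemma nneseries_ltyP (u : nat -> R) (C : R) : (forall n, 0 <= u n) ->
  (forall N, \sum_(0 <= n < N) u n <= C) -> (\sum_(0 <= n <oo) (u n)%:E < +oo)%E.
Proof.
move=> u0 uC; apply: (@le_lt_trans _ _ C%:E); last exact: ltry.
apply: lime_le; first by apply: is_cvg_nneseries => n _ _; rewrite lee_fin.
by near=> N; rewrite sumEFin lee_fin.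
Unshelve. all: by end_near. Qed.

(** The sixth powers are at most [(n + 1)^(-3/2) = (s n)^-3], which from the second term on is
    dominated by the differences of [- 2 / s n]. The bound 3 is the first term 1 plus the telescoped
    2. *)
Lemma ell6_alpha : ell 6 (alpha R).
Proof.
pose s n : R := Num.sqrt n.+1%:R.
have s1 n : 1 <= s n by rewrite -sqrtr1 ler_sqrt// ler1n.
have s2 n : s n ^+ 2 = n.+1%:R by rewrite sqr_sqrtr.
have ss n : s n <= s n.+1 by rewrite ler_sqrt// ler_nat.
have es n : envelope n ^+ 6 <= (s n)^-1 ^+ 3.
  have e2 : (n.+1%:R `^ 4^-1) ^+ 2 = s n :> R.
    apply/eqP; rewrite -(eqrXn2 (n := 2))// ?exprn_ge0 ?powR_ge0 ?sqrtr_ge0//.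
    by rewrite -exprM rootX4 s2.
  have -> : envelope n ^+ 6 = (2 / 3) ^+ 6 * (s n)^-1 ^+ 3.
    rewrite -e2 /envelope; field.
    by rewrite gt_eqF// powR_gt0.
  rewrite ler_piMl ?exprn_ge0 ?invr_ge0 ?sqrtr_ge0//.
  by apply: exprn_ile1; lra.
have step n : (s n.+1)^-1 ^+ 3 <= 2 * ((s n)^-1 - (s n.+1)^-1).
  have a0 : 0 < s n by apply: lt_le_trans (s1 n).
  have b0 : 0 < s n.+1 by apply: lt_le_trans (s1 n.+1).
  have e : s n.+1 ^+ 2 = s n ^+ 2 + 1 by rewrite !s2 -natr1.
  move: (s n) (s n.+1) a0 b0 (ss n) e => a b a0 b0 ab e.
  have ->: 2 * (a^-1 - b^-1) = 2 * b ^+ 2 * (b - a) / (a * b ^+ 3).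
    by field; rewrite !gt_eqF.
  have -> : b^-1 ^+ 3 = a / (a * b ^+ 3) by field; rewrite !gt_eqF.
  rewrite ler_pM2r ?invr_gt0 ?mulr_gt0 ?exprn_gt0//.
  (* [(b - a) (b + a) = 1] and [b + a <= 2 b] *)
  have h : 1 <= 2 * b * (b - a) by nra.
  apply: (@le_trans _ _ (b * 1)); first by rewrite mulr1.
  rewrite expr2 mulrA [2 * b]mulrC -!mulrA ler_pM2l//.
  by rewrite mulrA.
rewrite /ell; apply: (@nneseries_ltyP _ 3) => [n|N]; first exact: powR_ge0.
have le6 n : Normc.normc (alpha R n) `^ 6 <= (s n)^-1 ^+ 3.
  rewrite powR_mulrn ?normc_ge0// alphaE normc_real /alphaR.
  case: odd; last by rewrite gtr0_norm ?envelope_gt0.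
  by rewrite normr0 expr0n exprn_ge0// invr_ge0 sqrtr_ge0.
(* The extra term lets the first one be split off even when [N] is 0. *)
apply: (@le_trans _ _ (\sum_(0 <= n < N.+1) (s n)^-1 ^+ 3)).
  rewrite big_nat_recr// ler_wpDr ?exprn_ge0 ?invr_ge0 ?sqrtr_ge0//.
  by apply: ler_sum_nat => n _; exact: le6.
rewrite big_nat_recl//=.
have -> : s 0 = 1 by rewrite /s sqrtr1.
rewrite invr1 expr1n; suff : \sum_(0 <= i < N) (s i.+1)^-1 ^+ 3 <= 2 by lra.
apply: (@le_trans _ _ (\sum_(0 <= n < N) (- 2 * (s n.+1)^-1 - - 2 * (s n)^-1))).
  by apply: ler_sum_nat => n _; have := step n; lra.
rewrite (telescope_sumr (fun n => - 2 * (s n)^-1))// /s sqrtr1 invr1.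
have : 0 <= (s N)^-1 by rewrite invr_ge0 sqrtr_ge0.
by rewrite /s; lra.
Qed.

(** An upper bound on the size is enough, so the exact size of a concrete polynomial need not be
    computed. *)
Lemma shift_poly_widen (p : {poly R[i]}) x n m : (size p <= m)%N ->
  shift_poly p x n = \sum_(i < m) p`_i * x (n + i)%N.
Proof.
move=> pm; have it i y k : iter i (@Defs.shift R) y k = y (k + i)%N.
  elim: i k => [|i IH] k; first by rewrite addn0.
  by rewrite iterS /Defs.shift IH addSnnS.
rewrite /shift_poly; under eq_bigr do rewrite it.
rewrite (big_ord_widen m (fun i => p`_i * x (n + i)%N) pm) big_mkcond/=.
apply: eq_bigr => i _; case: ltnP => // h.
by rewrite nth_default ?mul0r.
Qed.

(** In [(alpha_{n+3} - alpha_{n+1}) - (alpha_{n+2} - alpha_n)] parity kills one bracket, and the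
    other is at most [envelope n - envelope (n + 3)] in modulus. These bounds telescope, and being
    below 1 they also dominate the squares. *)
Lemma ell2_alpha : ell 2 (shift_poly (('X - 1) ^+ 2 * ('X + 1)) (alpha R)).
Proof.
have valE n : shift_poly (('X - 1) ^+ 2 * ('X + 1)) (alpha R) n =
    (alphaR n.+3 - alphaR n.+2 - alphaR n.+1 + alphaR n)%:C.
  have -> : ('X - 1) ^+ 2 * ('X + 1) = 'X^3 - 'X^2 - 'X + 1 :> {poly R[i]} by ring.
  rewrite (@shift_poly_widen _ _ _ 4).
    rewrite !big_ord_recr big_ord0/= !(coefD, coefN, coefXn, coefX, coef1)/=.
    rewrite !alphaE !(addnS, addn0) !rmorphD/= !rmorphN/=; ring.
  rewrite (leq_trans (size_polyD _ _))// geq_max size_poly1 andbT.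
  rewrite (leq_trans (size_polyD _ _))// geq_max size_polyN size_polyX andbT.
  rewrite (leq_trans (size_polyD _ _))// geq_max size_polyN !size_polyXn//.
have bound n : `|alphaR n.+3 - alphaR n.+2 - alphaR n.+1 + alphaR n| <=
    envelope n - envelope n.+3.
  have h0 := envelope_nonincr (leqnSn n); have h1 := envelope_nonincr (leqnSn n.+1).
  have h2 := envelope_nonincr (leqnSn n.+2).
  rewrite /alphaR/= !negbK; case: odd => /=; rewrite ler_norml; apply/andP; split; lra.
apply: (@nneseries_ltyP _ 3) => [n|N]; first exact: powR_ge0.
pose G n := envelope n + envelope n.+1 + envelope n.+2.
apply: (@le_trans _ _ (\sum_(0 <= n < N) (- G n.+1 - - G n))); last first.
  rewrite (telescope_sumr (fun n => - G n))// /G.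
  have := envelope_gt0 N; have := envelope_gt0 N.+1; have := envelope_gt0 N.+2.
  have := envelope_lt1 0; have := envelope_lt1 1; have := envelope_lt1 2.
  by lra.
apply: ler_sum_nat => n _; rewrite valE powR_mulrn ?normc_ge0// normc_real.
have -> : - G n.+1 - - G n = envelope n - envelope n.+3 by rewrite /G; ring.
apply: le_trans (bound n); rewrite expr2 ler_piMl//.
apply: le_trans (bound n) _; have := envelope_gt0 n.+3; have := envelope_lt1 n.
by lra.
Qed.

(* from [sqrt (1 - x) <= 1 - x / 2 - x ^ 2 / 8] *)
Lemma ln_one_sub_le (x : R) : 0 <= x < 1 -> ln (1 - x) <= - x - x ^+ 2 / 4.
Proof.
move=> /andP[x0 x1].
set y := x / 2 + x ^+ 2 / 8.
have y1 : y < 1 by rewrite /y; nra.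
have -> : - x - x ^+ 2 / 4 = - y *+ 2 by rewrite /y mulr2n; field.
apply: (@le_trans _ _ (ln ((1 - y) ^+ 2))).
  rewrite ler_ln ?posrE ?subr_gt0 ?exprn_gt0 ?subr_gt0//.
  have -> : (1 - y) ^+ 2 = 1 - x + x ^+ 3 / 8 + x ^+ 4 / 64 by rewrite /y; field.
  by rewrite -!addrA lerD2l lerDl addr_ge0// divr_ge0// exprn_ge0.
rewrite lnXn ?subr_gt0// lerMn2r/= le_ln1Dx//.
by rewrite ltrN2.
Qed.

Lemma log_mean_sum_unbounded (M : R) : exists k : nat, M <=
  \sum_(j < k) (- ln (1 - alphaR j.+2.*2 ^+ 2) - alphaR j.+1.*2 * alphaR j.+2.*2) / 2.
Proof.
(* An eighth of [envelope (2 j + 4) ^ 4] is [2 / (81 (2 j + 5))], and [2 j + 5 <= 5 (j + 1)]. *)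
pose c : R := 2 / (81 * 5).
have term j : c * harmonic j - (envelope j.+1.*2 - envelope j.+2.*2) <=
  (- ln (1 - alphaR j.+2.*2 ^+ 2) - alphaR j.+1.*2 * alphaR j.+2.*2) / 2.
  rewrite !alphaR_even.
  have l : (j.+1.*2 <= j.+2.*2)%N by rewrite leq_double.
  have := envelope_nonincr l; have := envelope_gt0 j.+2.*2; have := envelope_lt1 j.+2.*2.
  have := envelopeX4 j.+2.*2; have := envelope_gt0 j.+1.*2.
  set a := envelope j.+1.*2; set b := envelope j.+2.*2 => a0 b4 b1 b0 ba.
  have b21 : 0 <= b ^+ 2 < 1 by rewrite exprn_ge0 ?ltW//= expr_lt1// ltW.
  have := ln_one_sub_le b21; rewrite -exprM b4.
  have cj : c * harmonic j <= (16 / (81 * (j.+2.*2.+1)%:R)) / 8.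
    rewrite /harmonic/= /c.
    have -> : 16 / (81 * (j.+2.*2.+1)%:R) / 8 = 2 / 81 * (j.+2.*2.+1)%:R^-1 :> R.
      by rewrite !invfM; move: (j.+2.*2.+1%:R^-1) => x; field.
    have -> : 2 / (81 * 5) * j.+1%:R^-1 = 2 / 81 * (5 * j.+1%:R)^-1 :> R.
      by rewrite !invfM; move: (j.+1%:R^-1) => x; field.
    rewrite ler_pM2l// lef_pV2 ?posrE ?mulr_gt0 ?ltr0n//.
    by rewrite -natrM ler_nat; lia.
  have : a * b - b ^+ 2 <= a - b by nra.
  move: cj; move: (16 / _) (c * _) (ln _) => x y L.
  by lra.
apply: contrapT => /forallNP h.
(* The telescoping correction is at most [envelope 2 < 1], whence the 1. *)
have hM k : c * series harmonic k <= M + 1.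
  have /negP := h k; rewrite -ltNge => /ltW hk.
  have : \sum_(0 <= j < k) (c * harmonic j - (envelope j.+1.*2 - envelope j.+2.*2)) <= M.
    by apply: le_trans hk; rewrite big_mkord; apply: ler_sum => j _; exact: term.
  rewrite sumrB -mulr_sumr -/(series harmonic k).
  have -> : \sum_(0 <= j < k) (envelope j.+1.*2 - envelope j.+2.*2) =
     envelope 1.*2 - envelope k.+1.*2.
    rewrite -[LHS]opprK -sumrN; under eq_bigr do rewrite opprB.
    by rewrite (telescope_sumr (fun j => envelope j.+1.*2))// opprB.
  have := envelope_gt0 k.+1.*2; have := envelope_lt1 1.*2.
  rewrite -[\sum_(0 <= i < k) harmonic i]/(series harmonic k).
  by lra.
apply: (@dvg_harmonic R); apply: nondecreasing_is_cvgn.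
  by apply: nondecreasing_series => n _ _; exact: harmonic_ge0.
exists ((M + 1) / c) => _ [k _ <-].
by rewrite ler_pdivlMr ?divr_gt0// mulrC hM.
Qed.

End VerblunskySequence.

(** * Measurability and boundedness of polynomials on the circle *)

Section PolynomialsOnCircle.
Variable R : realType.
Local Open Scope complex_scope.
Local Open Scope ring_scope.
Implicit Types (p q : {poly R[i]}) (z u : R[i]) (s t r x : R).

Lemma open_Re_gt x : open [set z : R[i]^o | x < complex.Re z].
Proof.
rewrite openE => z /= xz.
apply/nbhs_ballP; exists (complex.Re z - x)%:C => /=.
  by rewrite ltcR subr_gt0.
move=> y; rewrite /ball/= => yz.
have : `|complex.Re (z - y)| < complex.Re z - x.
  rewrite -ltcR; apply: le_lt_trans yz; exact: normc_ge_Re.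
by rewrite raddfB/= => /ltr_normlW; rewrite ltrD2l ltrN2.
Qed.

Lemma open_Im_gt x : open [set z : R[i]^o | x < complex.Im z].
Proof.
rewrite openE => z /= xz.
apply/nbhs_ballP; exists (complex.Im z - x)%:C => /=.
  by rewrite ltcR subr_gt0.
move=> y; rewrite /ball/= => yz.
have : `|complex.Im (z - y)| < complex.Im z - x.
  rewrite -ltcR; apply: le_lt_trans yz.
  have := normc_ge_Re ((z - y) * 'i); rewrite ReiNIm normrN normrM.
  by rewrite (_ : `|'i| = 1) ?mulr1// normc_def/= expr0n expr1n add0r sqrtr1.
by rewrite raddfB/= => /ltr_normlW; rewrite ltrD2l ltrN2.
Qed.

Lemma measurable_Re : measurable_fun [set: borelC R] (@complex.Re R).
Proof.
apply: (measurability _ (RGenOInfty.measurableE R)) => _ [_ [x ->] <-].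
rewrite setTI; apply: sub_sigma_algebra.
rewrite (_ : _ @^-1` _ = [set z : R[i]^o | x < complex.Re z]); first exact: open_Re_gt.
by apply/seteqP; split=> z /=; rewrite in_itv/= andbT.
Qed.

Lemma measurable_Im : measurable_fun [set: borelC R] (@complex.Im R).
Proof.
apply: (measurability _ (RGenOInfty.measurableE R)) => _ [_ [x ->] <-].
rewrite setTI; apply: sub_sigma_algebra.
rewrite (_ : _ @^-1` _ = [set z : R[i]^o | x < complex.Im z]); first exact: open_Im_gt.
by apply/seteqP; split=> z /=; rewrite in_itv/= andbT.
Qed.

Lemma measurable_horner p :
  measurable_fun [set: borelC R] (fun z => complex.Re p.[z]) /\
  measurable_fun [set: borelC R] (fun z => complex.Im p.[z]).
Proof.
have mr := measurable_Re; have mi := measurable_Im.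
elim/poly_ind: p => [|p c [IHr IHi]].
  by split; under eq_fun do rewrite horner0; exact: measurable_cst.
split.
  rewrite (_ : (fun z => _) = (fun z => (complex.Re p.[z] * complex.Re z -
      complex.Im p.[z] * complex.Im z) + complex.Re c)); last first.
    apply/funext => -[z1 z2]; rewrite hornerMXaddC.
    by case: (p.[_]) => a b; case: {+}c => c1 c2.
  by apply: measurable_funD => //; apply: measurable_funB; exact: measurable_funM.
rewrite (_ : (fun z => _) = (fun z => (complex.Re p.[z] * complex.Im z +
    complex.Im p.[z] * complex.Re z) + complex.Im c)); last first.
  apply/funext => -[z1 z2]; rewrite hornerMXaddC.
  by case: (p.[_]) => a b; case: {+}c => c1 c2.
by apply: measurable_funD => //; apply: measurable_funD; exact: measurable_funM.
Qed.

Lemma measurable_sqnormc_horner p :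
  measurable_fun [set: borelC R] (fun z => sqnormc p.[z]).
Proof.
have [mr mi] := measurable_horner p; rewrite /sqnormc.
by apply: measurable_funD; exact: measurable_funX.
Qed.

Lemma unit_circleE : @unit_circle R = [set z | sqnormc z = 1].
Proof.
apply/seteqP; split=> z; rewrite /unit_circle/= normc_def => h.
  case: h => /(congr1 (fun x => x ^+ 2)).
  by rewrite sqr_sqrtr ?addr_ge0 ?sqr_ge0// expr1n.
by move: h; rewrite /sqnormc => ->; rewrite sqrtr1.
Qed.

Lemma unit_circle_normc z : unit_circle z -> Normc.normc z = 1.
Proof.
rewrite unit_circleE/= sqnormc_normc => /eqP.
by rewrite sqrp_eq1 ?normc_ge0// => /eqP.
Qed.

Lemma unit_circle_expi t : unit_circle (expi t).
Proof. by rewrite unit_circleE/= sqnormc_normc normc_expi expr1n. Qed.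

Lemma measurable_unit_circle : measurable (@unit_circle R).
Proof.
have := measurable_sqnormc_horner 'X measurableT (measurable_set1 (1 : R)).
rewrite setTI unit_circleE; congr measurable.
by apply/seteqP; split=> z /=; rewrite hornerX.
Qed.

(** The bound is a natural number because it serves as the number of level sets in
    [integral_ac_part_le]. *)
Lemma sqnormc_horner_bound p :
  exists K : nat, forall z, unit_circle z -> sqnormc p.[z] <= K%:R.
Proof.
have [B hB] : exists B : R, forall z, unit_circle z -> Normc.normc p.[z] <= B.
  elim/poly_ind: p => [|p c [B hB]].
    by exists 0 => z _; rewrite horner0 Normc.normc0.
  exists (B + Normc.normc c) => z cz; rewrite hornerMXaddC.
  apply: le_trans (le_normcD _ _) _; rewrite lerD2r Normc.normcM.
  by rewrite (unit_circle_normc cz) mulr1 hB.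
exists (Num.truncn (B ^+ 2)).+1 => z cz; apply/ltW.
apply: (@le_lt_trans _ _ (B ^+ 2)); last exact: truncnS_gt.
rewrite sqnormc_normc; have := hB z cz; have := normc_ge0 p.[z].
by move=> h0 h1; rewrite lerXn2r// nnegrE// (le_trans h0).
Qed.

End PolynomialsOnCircle.

(** * Norms of the Gram-Schmidt polynomials *)

Section Normalisation.
Variable R : realType.
Local Open Scope complex_scope.
Local Open Scope ring_scope.
Variable mu : probability (borelC R) R.
Implicit Types (p q : {poly R[i]}).

Lemma integrable_sqnormc_horner p :
  mu.-integrable (@unit_circle R) (fun z => (sqnormc p.[z])%:E).
Proof.
apply: measurable_bounded_integrable.
exact: measurable_unit_circle.
by rewrite (le_lt_trans (probability_le1 mu _)) ?ltry//; exact: measurable_unit_circle.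
by apply: measurable_funTS; exact: measurable_sqnormc_horner.
have [K hK] := sqnormc_horner_bound p.
exists K%:R; split=> // x Kx z /= /hK h.
by rewrite ger0_norm ?sqnormc_ge0// (le_trans h)// ltW.
Qed.

Lemma Re_inner p :
  complex.Re (inner mu p p) = \int[mu]_(z in @unit_circle R) sqnormc p.[z].
Proof.
by apply: eq_Rintegral => z _; rewrite -[_^*]/(conjc _) mul_conjc.
Qed.

(** The integral is 1 if the residual has nonzero norm. Otherwise the convention [0^-1 = 0] turns
    the normalised polynomial into 0, so the inequality holds in both cases. *)
Lemma Re_inner_gs_step_le1 s p :
  \int[mu]_(z in @unit_circle R) sqnormc (gs_step mu s p).[z] <= 1.
Proof.
rewrite /gs_step; set r := p - _; set c := (l2norm mu r)^-1.
under eq_Rintegral do rewrite hornerZ sqnormcM sqnormc_real.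
rewrite RintegralZl; last exact: integrable_sqnormc_horner.
  rewrite -Re_inner /c /l2norm exprVn sqr_sqrtr; last first.
    by rewrite Re_inner; apply: Rintegral_ge0 => z _; exact: sqnormc_ge0.
  by have [->|n0] := eqVneq (complex.Re (inner mu r r)) 0; rewrite ?mulr0 ?mulVf.
exact: measurable_unit_circle.
Qed.

Lemma opuc0 : mu (@unit_circle R) = 1%E -> opuc mu 0 = 1.
Proof.
move=> mu1; rewrite /opuc/= /gs_step/= big_nil subr0 expr0 /l2norm Re_inner.
under eq_Rintegral do rewrite hornerC sqnormc_real expr1n.
rewrite Rintegral_cst; last exact: measurable_unit_circle.
by rewrite mul1r (_ : fine _ = 1) ?sqrtr1 ?invr1 ?scale1r//; move: mu1 => /(congr1 fine).
Qed.

End Normalisation.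

(** * Integrals against [w dtheta / 2 pi] bounded by integrals against [mu] *)

Section AbsolutelyContinuousPart.
Variable R : realType.
Local Open Scope complex_scope.
Local Open Scope ring_scope.
Local Notation leb := (@lebesgue_measure R).
Implicit Types (x : R).

(** The sum counts the positive integers up to both [x] and [K], so it is the minimum of [K] and the
    floor of [x]. *)
Lemma floor_sum_le x (K : nat) : 0 <= x ->
  \sum_(j < K) (j.+1%:R <= x)%R%:R <= x :> R /\
  (x <= K%:R -> x <= 1 + \sum_(j < K) (j.+1%:R <= x)%R%:R :> R).
Proof.
move=> x0.
have [h1 h2] : (K%:R <= x -> \sum_(j < K) (j.+1%:R <= x)%R%:R = K%:R :> R) /\
    (x < K%:R -> \sum_(j < K) (j.+1%:R <= x)%R%:R <= x
                 <= 1 + \sum_(j < K) (j.+1%:R <= x)%R%:R).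
  elim: K => [|K [IH1 IH2]]; first by rewrite big_ord0; split=> // /lt_geF; rewrite x0.
  rewrite big_ord_recr/= -natr1; split=> h.
    by rewrite h IH1//; apply: le_trans h; rewrite lerDl.
  rewrite [_ + 1 <= x]leNgt h/= addr0; case: (leP K%:R x) => [Kx|xK]; last exact: IH2.
  by rewrite IH1// Kx addrC ltW.
case: (leP K%:R x) => [Kx|xK].
  rewrite h1//; split=> // xK; apply: (le_trans xK); rewrite lerDr//.
by have /andP[] := h2 xK; split.
Qed.

Lemma measurable_boolR d (T : measurableType d) (D : set T) (b : T -> bool) :
  measurable D -> measurable_fun D b -> measurable_fun D (fun t => (b t)%:R : R).
Proof.
move=> mD mb; rewrite (_ : (fun t => _) = (fun t => if b t then 1 else 0)); last first.
  by apply/funext => t; case: (b t).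
by apply: measurable_fun_if => //; exact: measurable_cst.
Qed.

Variables (mu : {measure set (borelC R) -> \bar R}) (w : R -> R).
Hypothesis mw : measurable_fun (@angles R) w.
Hypothesis w_ge0 : forall t, angles t -> 0 <= w t.
Hypothesis w_le_mu : forall A : set (borelC R), measurable A ->
  (\int[leb]_(t in @angles R `&` @expi R @^-1` A) (w t / (2 * pi))%:E <= mu A)%E.

(* The level sets [{j + 1 <= g}] turn the comparison of measures into one of
   integrals, up to the total mass, because [g <= 1 + sum_j 1_{j + 1 <= g}]. *)
Lemma integral_ac_part_le (g : borelC R -> R) (K : nat) :
  measurable_fun [set: borelC R] g -> (forall z, 0 <= g z) ->
  (forall z, unit_circle z -> g z <= K%:R) ->
  measurable_fun (@angles R) (g \o @expi R) ->
  (\int[leb]_(t in @angles R) (g (expi t) * (w t / (2 * pi)))%:E <=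
   mu setT + \int[mu]_(z in @unit_circle R) (g z)%:E)%E.
Proof.
move=> mg g0 gK mge.
have mang : measurable (@angles R) := @measurable_angles R.
have mcirc : measurable (@unit_circle R) := @measurable_unit_circle R.
pose v t := w t / (2 * pi).
have v0 t : angles t -> 0 <= v t.
  by move=> at_; rewrite divr_ge0 ?w_ge0// ltW// twopi_gt0.
have mv : measurable_fun (@angles R) v by exact: measurable_funM.
pose A (j : nat) : set (borelC R) := [set z | j.+1%:R <= g z].
have mA j : measurable (A j).
  have := mg measurableT _ (measurable_itv `[j.+1%:R, +oo[).
  rewrite setTI; congr measurable.
  by apply/seteqP; split=> z; rewrite /A/= in_itv/= andbT.
pose b j t : R := (j.+1%:R <= g (expi t))%R%:R.
have mb j : measurable_fun (@angles R) (b j).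
  by apply: measurable_boolR => //; exact: measurable_fun_ler.
have mbv j : measurable_fun (@angles R) (fun t => (b j t * v t)%:E).
  by apply/measurable_EFinP; exact: measurable_funM.
have b0 j t : 0 <= b j t by exact: ler0n.
apply: (@le_trans _ _ (\int[leb]_(t in @angles R)
    ((v t)%:E + \sum_(j < K) (b j t * v t)%:E)%E)%E).
  apply: ge0_le_integral => //.
    by move=> t at_; rewrite lee_fin mulr_ge0// v0.
    by apply/measurable_EFinP; exact: measurable_funM.
    apply: emeasurable_funD; first exact/measurable_EFinP.
    by apply: emeasurable_sum => j; exact: mbv.
    move=> t at_; rewrite sumEFin -EFinD lee_fin -mulr_suml.
    rewrite -[X in _ <= X + _]mul1r -mulrDl ler_wpM2r ?v0//.
    have [_ h] := floor_sum_le K (g0 (expi t)); apply: h.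
    by apply: gK; exact: unit_circle_expi.
rewrite ge0_integralD//; first last.
  by apply: emeasurable_sum => j; exact: mbv.
  by move=> t at_; rewrite sumEFin lee_fin sumr_ge0// => j _; rewrite mulr_ge0// v0.
  exact/measurable_EFinP.
apply: leeD.
  by have := w_le_mu measurableT; rewrite preimage_setT setIT.
rewrite ge0_integral_sum//; first last.
  by move=> j t at_; rewrite lee_fin mulr_ge0// v0.
  by move=> j; exact: mbv.
have mI j : measurable_fun (@unit_circle R) (fun z : borelC R => (\1_(A j) z)%:E : \bar R).
  by apply/measurable_EFinP; apply: measurable_funTS; exact: measurable_indic.
apply: (@le_trans _ _ (\sum_(j < K) \int[mu]_(z in @unit_circle R) (\1_(A j) z)%:E)%E).
  apply: lee_sum => j _; rewrite integral_indic//.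
  have mAc : measurable (A j `&` @unit_circle R) by exact: measurableI.
  apply: le_trans (w_le_mu mAc); rewrite integral_mkcondr le_eqVlt; apply/orP; left.
  apply/eqP; apply: eq_integral => t _.
  rewrite patchE /b; case: ifPn => [|]; rewrite ?inE ?notin_setE/=.
    by move=> [+ _]; rewrite /A/= => ->; rewrite mul1r.
  have := unit_circle_expi t; rewrite /A/=.
  by case: (_ <= _) => // h /not_andP[]; rewrite ?mul0r.
rewrite -ge0_integral_sum//.
apply: ge0_le_integral => //.
  by move=> z _; rewrite sume_ge0.
  by apply: emeasurable_sum => j; exact: mI.
  by apply/measurable_EFinP; exact: measurable_funTS.
move=> z cz; rewrite sumEFin lee_fin.
have [h _] := floor_sum_le K (g0 z); apply: le_trans h; apply: ler_sum => j _.
rewrite indicE; case: (boolP (z \in A j)) => [|_]; last exact: ler0n.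
by rewrite inE /A/= => ->.
Qed.

End AbsolutelyContinuousPart.

(** * From unbounded means to a logarithmic integral equal to [-oo] *)

Section LogIntegral.
Variable R : realType.
Local Notation leb := (@lebesgue_measure R).
Variable w : R -> R.
Hypothesis mw : measurable_fun (@angles R) w.
Hypothesis w_ge0 : forall t, angles t -> 0 <= w t.

Local Notation f := (fun t => ((weight t)%:E * lne (w t)%:E)%E).

Lemma measurable_weight_lne : measurable_fun (@angles R) f.
Proof.
have mang : measurable (@angles R) := @measurable_angles R.
apply: emeasurable_funM.
  apply/measurable_EFinP; apply: measurable_funTS; apply: continuous_measurable_fun.
  exact: continuous_weight.
rewrite (_ : (fun t => _) = (fun t => if 0 < w t then (ln (w t))%:E else -oo%E)); last first.
  apply/funext => t; case: ltP => [w0|w0]; first by rewrite lne_EFin.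
  by rewrite le0_lneNy.
apply: measurable_fun_if => //; first by apply: measurable_fun_ltr.
  apply: measurableT_comp => //; apply: measurableT_comp; first exact: measurable_ln.
  by apply: measurable_funS mw => //; exact: subIsetl.
Qed.

(* [weight * ln (w * G) <= weight * w * G], split by [ln (w * G) = ln w + ln G] *)
Lemma weight_ln_le_funeneg (t G : R) : 0 <= w t -> 0 < G ->
  ((weight t * ln G - weight t * (w t * G))%:E <= (f^\- t)%E)%E.
Proof.
move=> wt G0; rewrite funenegE le_max; apply/orP.
have [w0|] := ltP 0 (w t).
  left; rewrite lne_EFin// -EFinM -EFinN lee_fin -[leRHS]mulrN -mulrBr ler_wpM2l ?weight_ge0//.
  have := ln_sublinear (mulr_gt0 w0 G0); rewrite lnM ?posrE//; lra.
(* At a zero of [w] the left side is 0. The negative part is [+oo] where the weight is positive;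
   where the weight vanishes, the bound 0 of the maximum suffices. *)
move=> w0; have -> : w t = 0 by apply/eqP; rewrite eq_le w0.
rewrite le0_lneNy// mul0r mulr0 subr0.
have [->|P0] := eqVneq (weight t) 0; first by right; rewrite mul0r.
by left; rewrite gt0_muleNy ?leey// lte_fin lt_def P0 weight_ge0.
Qed.

(** Integrating [weight_ln_le_funeneg] for [G k] bounds the integral of the negative part from below
    by [2 pi] times the mean, minus [B]. *)
Lemma integral_weight_lne_Ny (G : nat -> R -> R) (B : R) :
  (forall k t, 0 < G k t) -> (forall k, continuous (G k)) ->
  (forall k, (\int[leb]_(t in @angles R) (weight t * (w t * G k t))%:E <= B%:E)%E) ->
  (forall M, exists k, M <= circle_mean (fun t => weight t * ln (G k t))) ->
  (\int[leb]_(t in @angles R) f t = -oo)%E.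
Proof.
move=> G0 cG GB Gunb.
have mang : measurable (@angles R) := @measurable_angles R.
(* The sum of [-oo] and any extended real, [+oo] included, is [-oo] here, so the negative part alone
   decides. *)
suff fneg : (\int[leb]_(t in @angles R) f^\- t = +oo)%E.
  by rewrite integralE fneg addeNy.
apply/eqP; rewrite -leye_eq leNgt; apply/negP => fin.
have mfn : measurable_fun (@angles R) f^\-%E.
  by apply: measurable_funeneg; exact: measurable_weight_lne.
have ifn : leb.-integrable (@angles R) f^\-%E.
  apply/integrableP; split=> //.
  by under eq_integral do rewrite gee0_abs//.
set x := (\int[leb]_(t in @angles R) f^\- t)%E in fin.
have xfin : x \is a fin_num by exact: integrable_fin_num.
(* For this [k], [2 pi] times the mean exceeds [x + B] by at least [2 pi], against the bound
   [x + B]. *)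
have [k] := Gunb ((fine x + B) / (2 * pi) + 1).
have clnG : continuous (fun t => weight t * ln (G k t)).
  apply: continuous_fM; first exact: continuous_weight.
  move=> t; apply: (@continuous_comp _ _ _ (G k) (@ln R)); first exact: cG.
  exact: continuous_ln.
have ilnG := continuous_integrable_angles clnG.
have iwG : leb.-integrable (@angles R) (EFin \o (fun t => weight t * (w t * G k t))).
  apply/integrableP; split.
    apply/measurable_EFinP; apply: measurable_funM.
      by apply: measurable_funTS; apply: continuous_measurable_fun; exact: continuous_weight.
    by apply: measurable_funM => //; apply: measurable_funTS; apply: continuous_measurable_fun.
  apply: (@le_lt_trans _ _ B%:E); last exact: ltry.
  apply: le_trans (GB k); rewrite le_eqVlt; apply/orP; left; apply/eqP.
  apply: eq_integral => t; rewrite inE => at_.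
  by rewrite gee0_abs// lee_fin mulr_ge0 ?weight_ge0// mulr_ge0 ?w_ge0// ltW.
have : (\int[leb]_(t in @angles R)
    (weight t * ln (G k t) - weight t * (w t * G k t))%:E <= x)%E.
  apply: le_integral => //.
    exact: (integrableB _ ilnG iwG).
  by move=> t; rewrite inE => at_; apply: weight_ln_le_funeneg; rewrite ?w_ge0.
rewrite integralB_EFin//.
have -> : (\int[leb]_(t in @angles R) (weight t * ln (G k t))%:E)%E =
    (2 * pi * circle_mean (fun t => weight t * ln (G k t)))%:E.
  rewrite /circle_mean mulrA divff ?mul1r ?gt_eqF ?twopi_gt0//.
  by rewrite fineK//; exact: integrable_fin_num.
have Gfin : (\int[leb]_(t in @angles R) (weight t * (w t * G k t))%:E)%E \is a fin_num.
  exact: integrable_fin_num iwG.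
have := GB k; move: Gfin; move: (integral _ _ _) => y /fineK <-; rewrite lee_fin => yB.
rewrite -(fineK xfin) -EFinB lee_fin => h1 h2.
have : 2 * pi * ((fine x + B) / (2 * pi) + 1) <= fine x + B.
  apply: (@le_trans _ _ (2 * pi * circle_mean (fun t => weight t * ln (G k t)))).
    by rewrite ler_pM2l ?twopi_gt0.
  by lra.
rewrite mulrDr mulrCA divff ?gt_eqF ?twopi_gt0// !mulr1.
by have := twopi_gt0 R; lra.
Qed.

End LogIntegral.

(** * Application to [mu] and its orthonormal polynomials *)

Theorem corollary1p4 (R : realType) (mu : probability (borelC R) R)
    (w : R -> R)
    (mu_circle : mu (@unit_circle R) = 1%E)
    (mu_infinite : infinite_set (measure_support mu))
    (mu_verblunsky : verblunsky mu (@alpha R))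
    (w_density : ac_density mu w) :
  [/\ ell 2 (shift_poly (('X - 1) ^+ 2 * ('X + 1)) (@alpha R)),
      ell 6 (@alpha R) &
      ((2 * pi)^-1%:E * \int[lebesgue_measure]_(t in @angles R)
          (((1 - cos t) ^+ 2 * (1 + cos t))%:E * lne (w t)%:E))%E = -oo%E].

Proof.
have [mw w_ge0 [mus [_ muE]]] := w_density.
(* The singular part is nonnegative, so dropping it leaves [w dtheta / 2 pi] dominated by [mu]. *)
have w_le_mu (A : set (borelC R)) : measurable A ->
    (\int[lebesgue_measure]_(t in @angles R `&` @expi R @^-1` A)
       (w t / (2 * pi))%:E <= mu A)%E.
  by move=> mA; rewrite muE// leeDl.
have p0 : opuc mu 0 = 1 by exact: opuc0.
have p_rec n : 'X * opuc mu n =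
    (real_complex R (Num.sqrt (1 - alphaR R n ^+ 2))) *: opuc mu n.+1 +
    (real_complex R (alphaR R n)) *: revpoly n (opuc mu n).
  have [_ ->] := mu_verblunsky n; rewrite alphaE normc_real real_normK ?num_real//.
  by rewrite [_^*]conjc_real.
have a_lt1 := @alphaR_norm_lt1 R.
split; [exact: ell2_alpha|exact: ell6_alpha|].
pose G k t := sqnormc (opuc mu k.+2.*2).[expi t].
have GE k t : G k t = sqnormc (revpoly k.+2.*2 (opuc mu k.+2.*2)).[expi t].
  by rewrite (sqnormc_q_circle a_lt1 p0 p_rec)// normc_expi.
have qn0 n z : Normc.normc z <= 1 -> (revpoly n (opuc mu n)).[z] != 0.
  exact: (q_neq0 a_lt1 p0 p_rec).
suff -> : (\int[lebesgue_measure]_(t in @angles R)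
    (((1 - cos t) ^+ 2 * (1 + cos t))%:E * lne (w t)%:E) = -oo)%E.
  by rewrite gt0_muleNy// lte_fin invr_gt0 twopi_gt0.
(* [4 pi] is the bound 2 on the weight times the normalisation [2 pi]; the last 2 adds the total
   mass of [mu] and the squared norm of the polynomial, each at most 1. *)
apply: (@integral_weight_lne_Ny R w mw w_ge0 G (4 * pi * 2)).
  by move=> k t; rewrite GE sqnormc_gt0 qn0// normc_expi.
  by move=> k; exact: continuous_sqnormc_horner.
  move=> k; have [K hK] := sqnormc_horner_bound (opuc mu k.+2.*2).
  have cG : continuous (G k) by exact: continuous_sqnormc_horner.
  have mG : measurable_fun (@angles R) (G k).
    by apply: measurable_funTS; exact: continuous_measurable_fun.
  have mP : measurable_fun (@angles R) (@weight R).
    by apply: measurable_funTS; apply: continuous_measurable_fun; exact: continuous_weight.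
  have hint := integral_ac_part_le mw w_ge0 w_le_mu (measurable_sqnormc_horner _)
    (fun z => sqnormc_ge0 _) hK mG.
  have h2 : (\int[lebesgue_measure]_(t in @angles R)
      (G k t * (w t / (2 * pi)))%:E <= 2%:E)%E.
    apply: (le_trans hint); rewrite (_ : 2%:E = 1%:E + 1%:E)%E; last by rewrite -EFinD.
    apply: leeD; first exact: probability_le1.
    have := Re_inner_gs_step_le1 mu (gram_schmidt mu k.+2.*2) 'X^(k.+2.*2).
    rewrite -lee_fin; apply: le_trans; rewrite le_eqVlt fineK ?eqxx//.
    apply: integrable_fin_num; first exact: measurable_unit_circle.
    exact: integrable_sqnormc_horner.
  have Gw0 t : angles t -> 0 <= G k t * (w t / (2 * pi)).
    by move=> at_; rewrite mulr_ge0 ?sqnormc_ge0// divr_ge0 ?w_ge0// ltW// twopi_gt0.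
  have mGw : measurable_fun (@angles R) (fun t => G k t * (w t / (2 * pi))).
    by apply: measurable_funM => //; exact: measurable_funM.
  have p4 : 0 <= 4 * pi :> R by rewrite mulr_ge0// pi_ge0.
  apply: (@le_trans _ _ ((4 * pi)%:E * \int[lebesgue_measure]_(t in @angles R)
      (G k t * (w t / (2 * pi)))%:E)%E); last first.
    by rewrite [(4 * pi * 2)%:E]EFinM lee_wpmul2l.
  rewrite -ge0_integralZl//; first last.
  by exact/measurable_EFinP.
  exact: measurable_angles.
  apply: ge0_le_integral.
  exact: measurable_angles.
  by move=> t at_; rewrite lee_fin mulr_ge0 ?weight_ge0// mulr_ge0 ?w_ge0 ?sqnormc_ge0.
  by apply/measurable_EFinP; apply: measurable_funM => //; exact: measurable_funM.
  by apply/measurable_EFinP; exact: measurable_funM.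
  move=> t at_; rewrite -EFinM lee_fin.
  have -> : 4 * pi * (G k t * (w t / (2 * pi))) = 2 * (w t * G k t).
    have pi0 : pi != 0 :> R by rewrite gt_eqF// pi_gt0.
    by move: (pi) pi0 (w t) (G k t) => c c0 x y; field; exact: c0.
  by rewrite ler_wpM2r ?weight_le2// mulr_ge0 ?w_ge0 ?sqnormc_ge0.
move=> M; have [k hk] := log_mean_sum_unbounded (M - log_mean (revpoly 4 (opuc mu 4))).
exists k; rewrite (_ : circle_mean _ = circle_log_mean (revpoly k.+2.*2 (opuc mu k.+2.*2))).
  rewrite circle_log_meanE; last exact: qn0.
  rewrite (log_mean_q a_lt1 p0 p_rec); last exact: alphaR_odd.
  by rewrite -lerBlDl.
by congr circle_mean; apply/funext => t; rewrite GE.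
Qed.
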